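(* Let $P$ be a finite Eulerian Sheffer poset of even rank $n=2m+2\geq 4$ with $B(3)=6$ and $D(3)=4$. Then $\alpha=\frac{B(2m+1)}{(2m+1)!}$ is a positive integer and $P\cong\Sigma^*(\boxplus^\alpha(B_{2m+1}))$; consequently $B(k)=k!$ for $1\leq k\leq 2m$, $B(2m+1)=\alpha(2m+1)!$, $D(1)=1$, $D(k)=2(k-1)!$ for $2\leq k\leq 2m+1$, and $D(2m+2)=2\alpha(2m+1)!$.
   Context: A finite graded poset with minimum $\hat 0$ and maximum $\hat 1$ is Eulerian if every interval $[x,y]$ with $x<y$ has as many elements of even rank as of odd rank. A finite Sheffer poset is a finite poset with $\hat 0$ and $\hat 1$ in which every interval is graded, any two intervals $[\hat 0,y]$ of the same length $n$ have the same number $D(n)$ of maximal chains (Sheffer factorial function), and any two intervals $[x,y]$ of the same length $n$ with $x\neq\hat 0$ have the same number $B(n)$ of maximal chains (binomial factorial function). $B_n$ is the boolean lattice of subsets of $\{1,\dots,n\}$ ordered by inclusion. For a poset $Q$ with unique minimum and maximum, $\boxplus^k(Q)$ is obtained from $k$ disjoint copies of $Q$ by identifying all minimum elements into one and all maximum elements into one. For a poset $R$ with minimum $\hat 0$, the dual suspension $\Sigma^*(R)$ is $R$ together with two new incomparable elements $a_1,a_2$, ordered so that $\hat 0<a_i<y$ for every $y>\hat 0$ in $R$ and $i=1,2$. *)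

(* Defs.v *)
From HB Require Import structures.
From mathcomp Require Import all_boot all_order all_algebra.

Set Implicit Arguments.
Unset Strict Implicit.
Unset Printing Implicit Defensive.

Import Order.TTheory.

Local Open Scope order_scope.

Section Chains.
Context {d : Order.disp_t} {P : finPOrderType d}.
Implicit Types (x y : P) (C : {set P}).

Definition itvset x y : {set P} := [set z | x <= z <= y].

Definition chain_in x y C : bool :=
  (C \subset itvset x y) && [forall a in C, forall b in C, a >=< b].

Definition maxchains x y : {set {set P}} := [set C | maxset (chain_in x y) C].

Definition nmaxchains x y : nat := #|maxchains x y|.

Definition graded_itv x y : Prop :=
  forall C C', C \in maxchains x y -> C' \in maxchains x y -> #|C| = #|C'|.

(* Length of a longest chain of [x, y]; a chain with k + 1 elements has
   length k. *)
Definition itv_length x y : nat := (\max_(C : {set P} | chain_in x y C) #|C|).-1.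

End Chains.

Section EulerianSheffer.
Context {d : Order.disp_t}.
Implicit Type P : finTBPOrderType d.

Definition rank P (x : P) : nat := itv_length \bot x.

Definition poset_rank P : nat := rank (\top : P).

Definition eulerian P : Prop :=
  graded_itv (\bot : P) \top /\
  forall x y : P, x < y ->
    #|[set z in itvset x y | ~~ odd (rank z)]| =
    #|[set z in itvset x y | odd (rank z)]|.

Definition sheffer P : Prop :=
  [/\ forall x y : P, x <= y -> graded_itv x y,
      forall y y' : P,
        itv_length \bot y = itv_length \bot y' ->
        nmaxchains \bot y = nmaxchains \bot y'
    & forall x y x' y' : P,
        x <= y -> x' <= y' -> x != \bot -> x' != \bot ->
        itv_length x y = itv_length x' y' ->
        nmaxchains x y = nmaxchains x' y'].

(* The two factorial functions of a Sheffer poset.  They are read off an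
   arbitrary interval of length n of the relevant kind, and take the junk value
   0 when there is none. *)
Definition sheffer_fact P (n : nat) : nat :=
  if [pick y : P | itv_length \bot y == n] is Some y
  then nmaxchains \bot y else 0.

Definition binomial_fact P (n : nat) : nat :=
  if [pick p : P * P |
        [&& p.1 != \bot, p.1 <= p.2 & itv_length p.1 p.2 == n]] is Some p
  then nmaxchains p.1 p.2 else 0.

End EulerianSheffer.

Definition poset_iso (d d' : Order.disp_t)
    (P : porderType d) (Q : porderType d') : Prop :=
  exists2 f : P -> Q, bijective f & {mono f : x y / x <= y}.

(* k copies of Q glued along their minima and along their maxima: one common
   minimum, one common maximum, and k copies of the rest of Q.  This is the
   intended poset as soon as the minimum and the maximum of Q differ. *)
Section Boxplus.
Context {d : Order.disp_t} (k : nat) (Q : finTBPOrderType d).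

Inductive boxplus : predArgType :=
  | BpBot
  | BpTop
  | BpIn of 'I_k & {x : Q | (x != \bot) && (x != \top)}.

Definition boxplus_enc (u : boxplus) :=
  match u with
  | BpBot => None
  | BpTop => Some None
  | BpIn i x => Some (Some (i, x))
  end.

Definition boxplus_dec u : boxplus :=
  match u with
  | None => BpBot
  | Some None => BpTop
  | Some (Some (i, x)) => BpIn i x
  end.

Lemma boxplus_encK : cancel boxplus_enc boxplus_dec.
Proof. by case. Qed.

HB.instance Definition _ := Finite.copy boxplus (can_type boxplus_encK).

Definition boxplus_le (u v : boxplus) : bool :=
  match u, v with
  | BpBot, _ => true
  | _, BpTop => true
  | BpIn i x, BpIn j y => (i == j) && (val x <= val y)
  | _, _ => false
  end.

Lemma boxplus_le_refl : reflexive boxplus_le.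
Proof. by case=> //= i x; rewrite eqxx lexx. Qed.

Lemma boxplus_le_anti : antisymmetric boxplus_le.
Proof.
case=> [||i x] [||j y] //= /andP[/andP[/eqP-> xy] /andP[_ yx]].
by congr BpIn; apply/val_inj/le_anti; rewrite xy yx.
Qed.

Lemma boxplus_le_trans : transitive boxplus_le.
Proof.
case=> [||j y] [||i x] [||l z] //= /andP[/eqP-> xy] /andP[/eqP-> yz].
by rewrite eqxx (le_trans xy yz).
Qed.

HB.instance Definition _ := Order.Le_isPOrder.Build d boxplus
  boxplus_le_refl boxplus_le_anti boxplus_le_trans.

Lemma boxplus_le0x (u : boxplus) : BpBot <= u.
Proof. by []. Qed.

Lemma boxplus_lex1 (u : boxplus) : u <= BpTop.
Proof. by case: u. Qed.

HB.instance Definition _ := Order.hasBottom.Build d boxplus boxplus_le0x.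
HB.instance Definition _ := Order.hasTop.Build d boxplus boxplus_lex1.

End Boxplus.

Section DualSuspension.
Context {d : Order.disp_t} (R : finBPOrderType d).

(* DsNew false and DsNew true are the two new elements a_1 and a_2. *)
Inductive dual_susp : predArgType :=
  | DsOld of R
  | DsNew of bool.

Definition dual_susp_enc (u : dual_susp) : R + bool :=
  match u with DsOld x => inl x | DsNew b => inr b end.

Definition dual_susp_dec (u : R + bool) : dual_susp :=
  match u with inl x => DsOld x | inr b => DsNew b end.

Lemma dual_susp_encK : cancel dual_susp_enc dual_susp_dec.
Proof. by case. Qed.

HB.instance Definition _ := Finite.copy dual_susp (can_type dual_susp_encK).

Definition dual_susp_le (u v : dual_susp) : bool :=
  match u, v with
  | DsOld x, DsOld y => x <= y
  | DsOld x, DsNew _ => x == \bot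
  | DsNew _, DsOld y => \bot < y
  | DsNew a, DsNew b => a == b
  end.

Lemma dual_susp_le_refl : reflexive dual_susp_le.
Proof. by case=> /= [x|b]. Qed.

Lemma dual_susp_le_anti : antisymmetric dual_susp_le.
Proof.
case=> [x|a] [y|b] //=.
- by move=> /le_anti ->.
- by move=> /andP[/eqP->]; rewrite ltxx.
- by move=> /andP[+ /eqP yE]; rewrite yE ltxx.
- by move=> /andP[/eqP->].
Qed.

Lemma dual_susp_le_trans : transitive dual_susp_le.
Proof.
case=> [y|b] [x|a] [z|c] //=.
- exact: le_trans.
- by move=> xy /eqP yE; rewrite yE lex0 in xy.
- exact: lt_le_trans.
- by move=> + /eqP yE; rewrite yE ltxx.
- by move=> /eqP-> _; exact: le0x.
- by move=> /eqP->.
Qed.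

HB.instance Definition _ := Order.Le_isPOrder.Build d dual_susp
  dual_susp_le_refl dual_susp_le_anti dual_susp_le_trans.

End DualSuspension.

Import Order.DefaultSetSubsetOrder.

(* The subsets of 'I_n, ordered by inclusion. *)
Definition boolean_lattice (n : nat) :
    finTBPOrderType Order.SetSubsetOrder.subset_display := {set 'I_n}.

(* Main.v *)
(** Write [A(n)] for the number of atoms of an interval of length [n] not
    starting at the bottom.  In an even length [n], the Euler relation reduces
    to [A(n) A(n-1) = n (A(n) - 1)], and with [A(n) >= A(n-1) >= A(n-2)] this
    forces [B(k) = k!] for [k <= 2m]; counting coatoms then shows that every
    interval [[x, y]] with [x] not the bottom, of length at most [2m], is boolean.
    For the lower intervals, the atoms below an element of odd rank pair up
    because every element of rank 2 or 3 has exactly two atoms below it, and the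
    Euler relation then leaves exactly two atoms below any element of rank at
    least 2.  So [P] is the dual suspension of [[a, 1]], where [a] is an atom.
    In [[a, 1]], having a common upper bound other than [1] is an equivalence
    relation on the atoms, with classes of size [2m + 1], and an element other
    than [1] is determined by the set of atoms below it, an arbitrary proper
    subset of a class: each class spans one copy of the boolean lattice. *)

Require Import Defs.
From mathcomp Require Import all_boot all_order all_algebra.
From mathcomp Require Import zify ring lra.

Set Implicit Arguments.
Unset Strict Implicit.
Unset Printing Implicit Defensive.

Import Order.TTheory.

(** * Maximal chains of intervals *)

Section MaximalChains.
Context {d : Order.disp_t} {P : finPOrderType d}.
Implicit Types (x y z : P) (C : {set P}).

(** In a graded interval this is the set of elements of rank [k] relative to [x]. Level 1 consists
    of the atoms of the interval, level [(itv_length x y).-1] of its coatoms. *)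
Definition lvl x y k : {set P} :=
  [set z | (x <= z <= y)%O & itv_length x z == k].

Lemma chain_inP x y C :
  reflect ((forall a, a \in C -> (x <= a <= y)%O) /\
           {in C &, forall a b, (a >=< b)%O}) (chain_in x y C).
Proof.
apply: (iffP andP) => [[/subsetP sC /forall_inP cC]|[sC cC]]; split.
- by move=> a /sC; rewrite inE.
- by move=> a b aC bC; move/forall_inP: (cC a aC); apply.
- by apply/subsetP => a /sC; rewrite inE.
- by apply/forall_inP => a aC; apply/forall_inP => b bC; apply: cC.
Qed.

Lemma maxchain_sub x y C :
  chain_in x y C -> exists2 C', C' \in maxchains x y & C \subset C'.
Proof.
by move=> /maxset_exists [C' maxC' sC]; exists C'; rewrite ?inE.
Qed.

Lemma maxchain_chain x y C : C \in maxchains x y -> chain_in x y C.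
Proof. by rewrite inE => /maxsetp. Qed.

Lemma maxchain_add x y C z : C \in maxchains x y -> (x <= z <= y)%O ->
  (forall a, a \in C -> (a >=< z)%O) -> z \in C.
Proof.
rewrite inE => /maxsetP[/chain_inP[sC cC] maxC] xzy zC.
rewrite -(maxC (z |: C)) ?setU11 ?subsetUr //.
apply/chain_inP; split=> [a /setU1P[->//|/sC//]|a b /setU1P[->|aC] /setU1P[->|bC]].
- exact: comparablexx.
- by rewrite comparable_sym zC.
- exact: zC.
- exact: cC.
Qed.

Lemma maxchain_bot x y C : (x <= y)%O -> C \in maxchains x y -> x \in C.
Proof.
move=> xy maxC; have /chain_inP[sC _] := maxchain_chain maxC.
apply: maxchain_add maxC _ _; first by rewrite lexx.
by move=> a /sC /andP[xa _]; rewrite comparable_sym le_comparable.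
Qed.

Lemma maxchain_top x y C : (x <= y)%O -> C \in maxchains x y -> y \in C.
Proof.
move=> xy maxC; have /chain_inP[sC _] := maxchain_chain maxC.
apply: maxchain_add maxC _ _; first by rewrite lexx xy.
by move=> a /sC /andP[_ xa]; rewrite le_comparable.
Qed.

Lemma chain_in_refl x C : chain_in x x C -> C \subset [set x].
Proof.
by move=> /chain_inP[sC _]; apply/subsetP => a /sC; rewrite inE -eq_le eq_sym.
Qed.

Lemma maxchains_refl x : maxchains x x = [set [set x]].
Proof.
apply/setP => C; rewrite in_set1; apply/idP/eqP => [maxC|->].
  apply/eqP; rewrite eqEsubset sub1set (maxchain_bot _ maxC) // andbT.
  exact: chain_in_refl (maxchain_chain maxC).
have [|C' maxC' sC'] := @maxchain_sub x x [set x].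
  apply/chain_inP; split=> [a /set1P->|a b /set1P-> /set1P->]; first by rewrite lexx.
  exact: comparablexx.
suff -> : [set x] = C' by [].
by apply/eqP; rewrite eqEsubset sC' chain_in_refl // maxchain_chain.
Qed.

Lemma itv_length_refl x : itv_length x x = 0.
Proof.
rewrite /itv_length; apply/eqP; rewrite -leqn0 -subn1 leq_subLR.
apply/bigmax_leqP => C /chain_in_refl /subset_leq_card.
by rewrite cards1.
Qed.

Lemma card_maxchain x y C : (x <= y)%O -> graded_itv x y ->
  C \in maxchains x y -> #|C| = (itv_length x y).+1.
Proof.
move=> xy gr maxC; rewrite /itv_length.
suff -> : \max_(C : {set P} | chain_in x y C) #|C| = #|C|.
  by rewrite prednK // card_gt0; apply/set0Pn; exists x; apply: maxchain_bot maxC.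
apply/eqP; rewrite eqn_leq; apply/andP; split; last first.
  exact: leq_bigmax_cond (maxchain_chain maxC).
apply/bigmax_leqP => C' /maxchain_sub[C'' maxC'' /subset_leq_card].
by rewrite (gr _ _ maxC'' maxC).
Qed.

Definition covers x z := (x < z)%O && [forall w, ~~ (x < w < z)%O].

Lemma coversP x z : reflect ((x < z)%O /\ forall w, ~ (x < w < z)%O) (covers x z).
Proof.
apply: (iffP andP) => -[xz]; first by move=> /forallP h; split=> // w; apply/negP.
by move=> h; split=> //; apply/forallP => w; apply/negP.
Qed.

(** A chain extending [x |: C] contains [z]. Nothing lies strictly between [x] and [z], so its
    elements other than [x] are above [z], and maximality of [C] puts them in [C]. *)
Lemma maxchain_cons x y z C : covers x z -> (z <= y)%O ->
  C \in maxchains z y -> x |: C \in maxchains x y.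
Proof.
move=> /coversP[xz cov] zy maxC.
have /chain_inP[sC cC] := maxchain_chain maxC.
have zC := maxchain_bot zy maxC.
rewrite inE; apply/maxsetP; split.
  apply/chain_inP; split.
    move=> a /setU1P[->|/sC/andP[za ->]]; first by rewrite lexx (le_trans (ltW xz)).
    by rewrite (le_trans (ltW xz)).
  have xC a : a \in C -> (x <= a)%O.
    by move=> /sC/andP[za _]; rewrite (le_trans (ltW xz)).
  move=> a b /setU1P[->|aC] /setU1P[->|bC]; rewrite ?comparablexx //; last exact: cC.
    by rewrite le_comparable ?xC.
  by rewrite comparable_sym le_comparable ?xC.
move=> C' /chain_inP[sC' cC'] sCC'; apply/eqP; rewrite eqEsubset sCC' andbT.
have zC' : z \in C' by apply: (subsetP sCC'); rewrite setU1r.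
apply/subsetP => w wC'; rewrite in_setU1; case: eqVneq => //= wx.
have /andP[xw wy] := sC' w wC'.
have zw : (z <= w)%O.
  case/orP: (cC' z w zC' wC') => //; rewrite le_eqVlt => /orP[/eqP->//|wz].
  by case: (cov w); rewrite wz andbT lt_neqAle eq_sym wx.
apply: maxchain_add maxC _ _; first by rewrite zw.
by move=> a aC; apply: cC' => //; apply: (subsetP sCC'); rewrite setU1r.
Qed.

(** Converse of [maxchain_cons]: [z] is the least element of [C] after [x]. An element strictly
    between [x] and [z] would be comparable to all of [C], hence in [C], against minimality. *)
Lemma maxchain_behead x y C : (x < y)%O -> C \in maxchains x y ->
  exists z, [/\ covers x z, (z <= y)%O & C :\ x \in maxchains z y].
Proof.
move=> xy maxC; have /chain_inP[sC cC] := maxchain_chain maxC.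
have yC : y \in C :\ x.
  by rewrite !inE (maxchain_top (ltW xy) maxC) gt_eqF.
have [z zC minz] : exists2 z, z \in C :\ x & forall w, w \in C :\ x -> (z <= w)%O.
  (* The least element is obtained as the one with fewest elements of [C :\ x] below it; on a chain
     this count is strictly monotone. *)
  have := @arg_minnP _ y (mem (C :\ x)) (fun z => #|[set w in C :\ x | (w <= z)%O]|) yC.
  case=> z zC minz; exists z => // w wC.
  have /orP[//|wz] : (z >=< w)%O.
    by move: zC wC; rewrite !inE => /andP[_ ?] /andP[_ ?]; apply: cC.
  have := minz w wC; apply: contraTT => zw.
  rewrite -ltnNge proper_card //; apply/properP; split.
    by apply/subsetP => a; rewrite !inE => /andP[-> /le_trans->].
  by exists z; rewrite !inE ?(negPf zw) ?andbF // lexx andbT; move: zC; rewrite !inE.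
have xz : (x < z)%O.
  by move: zC; rewrite !inE lt_neqAle eq_sym => /andP[-> /sC/andP[->]].
have zy : (z <= y)%O by apply: minz.
have cov : covers x z.
  apply/coversP; split=> // w /andP[xw wz].
  have wC : w \in C.
    apply: maxchain_add maxC _ _.
      by rewrite (ltW xw) (le_trans (ltW wz)).
    move=> a aC; case: (eqVneq a x) => [->|ax]; first by rewrite le_comparable ?ltW.
    rewrite comparable_sym le_comparable // (le_trans (ltW wz)) // minz //.
    by rewrite !inE ax.
  have : (z <= w)%O by rewrite minz // !inE wC andbT gt_eqF.
  by rewrite lt_geF.
exists z; split=> //; rewrite inE; apply/maxsetP; split.
  apply/chain_inP; split=> [a aC|a b].
    by rewrite minz //=; move: aC; rewrite !inE => /andP[_ /sC/andP[]].
  by rewrite !inE => /andP[_ ?] /andP[_ ?]; apply: cC.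
move=> C' /chain_inP[sC' cC'] sCC'; apply/eqP; rewrite eqEsubset sCC' andbT.
apply/subsetP => w wC'; have /andP[zw wy] := sC' w wC'.
rewrite !inE gt_eqF ?(lt_le_trans xz) //=.
apply: maxchain_add maxC _ _; first by rewrite wy (le_trans (ltW xz)).
move=> a aC; case: (eqVneq a x) => [->|ax].
  by rewrite le_comparable // (le_trans (ltW xz)).
by apply: cC' => //; apply: (subsetP sCC'); rewrite !inE ax.
Qed.

End MaximalChains.

(** * Additivity of length and counts of maximal chains in graded intervals *)

Section GradedIntervals.
Context {d : Order.disp_t} {P : finPOrderType d}.
Hypothesis gr : forall x y : P, (x <= y)%O -> graded_itv x y.
Implicit Types (x y z : P) (C : {set P}).

Lemma maxchain_ex x y : (x <= y)%O -> exists C, C \in maxchains x y.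
Proof.
move=> xy; have [|C maxC _] := @maxchain_sub _ _ x y set0; last by exists C.
by apply/chain_inP; split=> [a|a b]; rewrite inE.
Qed.

Lemma nmaxchains_gt0 x y : (x <= y)%O -> 0 < nmaxchains x y.
Proof. by move=> /maxchain_ex[C maxC]; apply/card_gt0P; exists C. Qed.

Lemma nmaxchains_refl x : nmaxchains x x = 1.
Proof. by rewrite /nmaxchains maxchains_refl cards1. Qed.

Lemma itv_length_covers x y z :
  covers x z -> (z <= y)%O -> itv_length x y = (itv_length z y).+1.
Proof.
move=> cov zy; have [xz _] := coversP _ _ cov.
have [C maxC] := maxchain_ex zy.
have := card_maxchain zy (gr zy) maxC.
have xy : (x <= y)%O by rewrite (le_trans (ltW xz)).
have := card_maxchain xy (gr xy) (maxchain_cons cov zy maxC).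
rewrite cardsU1; have -> : x \notin C; last by lia.
apply/negP => xC; have /chain_inP[sC _] := maxchain_chain maxC.
by have /andP[] := sC x xC; rewrite lt_geF.
Qed.

Lemma covers_ex x y : (x < y)%O -> exists2 z, covers x z & (z <= y)%O.
Proof.
move=> xy; have [C maxC] := maxchain_ex (ltW xy).
by have [z [cov zy _]] := maxchain_behead xy maxC; exists z.
Qed.

Lemma itv_length_add x z y : (x <= z)%O -> (z <= y)%O ->
  itv_length x y = itv_length x z + itv_length z y.
Proof.
have [n] := ubnP (itv_length x z); elim: n x => // n IH x.
rewrite ltnS => le_n; rewrite le_eqVlt => /orP[/eqP->|xz] zy.
  by rewrite itv_length_refl.
have [c cov cz] := covers_ex xz.
rewrite !(@itv_length_covers x _ c) // ?(le_trans cz) //.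
by rewrite (IH c) //; move: le_n; rewrite (itv_length_covers cov cz).
Qed.

Lemma itv_length_gt0 x y : (x < y)%O -> 0 < itv_length x y.
Proof. by move=> /covers_ex[z cov zy]; rewrite (itv_length_covers cov zy). Qed.

Lemma itv_length_eq0 x y : (x <= y)%O -> itv_length x y = 0 -> x = y.
Proof.
by rewrite le_eqVlt => /orP[/eqP//|/itv_length_gt0]; case: itv_length.
Qed.

Lemma coversE x z : (x <= z)%O -> covers x z = (itv_length x z == 1).
Proof.
move=> xz; apply/idP/eqP => [cov|l1].
  by rewrite (itv_length_covers cov) ?lexx // itv_length_refl.
apply/coversP; split.
  by rewrite lt_neqAle xz andbT; apply/eqP => xz'; rewrite xz' itv_length_refl in l1.
move=> w /andP[xw wz]; have := itv_length_add (ltW xw) (ltW wz).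
by have := itv_length_gt0 xw; have := itv_length_gt0 wz; lia.
Qed.

Lemma in_lvl x y k z :
  (z \in lvl x y k) = [&& (x <= z)%O, (z <= y)%O & itv_length x z == k].
Proof. by rewrite inE andbA. Qed.

Lemma in_lvl1 x y z : (z \in lvl x y 1) = covers x z && (z <= y)%O.
Proof.
rewrite in_lvl andbC -andbA; apply/idP/idP => [/and3P[-> l1 xz]|/andP[cov ->]].
  by rewrite coversE // l1.
have [xz _] := coversP _ _ cov.
by rewrite (ltW xz) /= andbT -coversE ?(ltW xz).
Qed.

Lemma nmaxchains_rec x y : (x < y)%O ->
  nmaxchains x y = \sum_(z in lvl x y 1) nmaxchains z y.
Proof.
move=> xy; rewrite /nmaxchains.
have -> : maxchains x y =
  \bigcup_(z in lvl x y 1) [set x |: C | C in maxchains z y].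
  apply/setP => C; apply/idP/bigcupP => [maxC|[z]].
    have [z [cov zy maxC']] := maxchain_behead xy maxC.
    exists z; first by rewrite in_lvl1 cov zy.
    apply/imsetP; exists (C :\ x) => //.
    by rewrite setD1K // (maxchain_bot (ltW xy) maxC).
  rewrite in_lvl1 => /andP[cov zy] /imsetP[C' maxC' ->].
  exact: (maxchain_cons cov zy maxC').
have xnin z C : z \in lvl x y 1 -> C \in maxchains z y -> x \notin C.
  rewrite in_lvl1 => /andP[/coversP[xz _] zy] maxC; apply/negP => xC.
  have /chain_inP[sC _] := maxchain_chain maxC.
  by have /andP[] := sC x xC; rewrite lt_geF.
(* The family is padded with [set0] because the disjoint-union formula ranges over the whole
   type. *)
pose F z := if z \in lvl x y 1 then [set x |: C | C in maxchains z y] else set0.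
have -> : \bigcup_(z in lvl x y 1) [set x |: C | C in maxchains z y] = \bigcup_z F z.
  by rewrite big_mkcond.
rewrite -sum1_card partition_disjoint_bigcup => [|z z' zz'].
  rewrite [RHS]big_mkcond; apply: eq_bigr => z _; rewrite sum1_card /F.
  case: ifP => [zl|_]; last by rewrite cards0.
  apply: card_in_imset => C C' maxC maxC' /(congr1 (fun D => D :\ x)).
  by rewrite !setU1K ?(xnin z).
rewrite disjoints_subset; apply/subsetP => C CF; rewrite inE; apply/negP; move: CF; rewrite /F.
case: ifP => [zl|_]; last by rewrite inE.
case: ifP => [zl'|_]; last by rewrite inE.
move=> /imsetP[D maxD ->] /imsetP[D' maxD'] /(congr1 (fun D => D :\ x)).
rewrite (setU1K (xnin z D zl maxD)) (setU1K (xnin z' D' zl' maxD')) => DD'.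
have := zl; have := zl'; rewrite !in_lvl1 => /andP[_ zy'] /andP[_ zy].
have /chain_inP[sD _] := maxchain_chain maxD.
have /chain_inP[sD' _] := maxchain_chain maxD'.
have /sD' /andP[z'z _] : z \in D' by rewrite -DD' (maxchain_bot zy maxD).
have /sD /andP[zz'' _] : z' \in D by rewrite DD' (maxchain_bot zy' maxD').
by move: zz'; rewrite (@le_anti _ _ z z') ?eqxx // z'z zz''.
Qed.

(** Every maximal chain meets level [k] exactly once and splits there. By induction on [k]: the
    first atom is peeled off with [nmaxchains_rec], and the sums over atoms and over level [k.+1]
    are exchanged. *)
Lemma nmaxchains_lvl x y k : (x <= y)%O -> k <= itv_length x y ->
  nmaxchains x y = \sum_(z in lvl x y k) nmaxchains x z * nmaxchains z y.
Proof.
elim: k x => [|k IH] x xy kl.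
  rewrite (big_pred1 x) ?nmaxchains_refl ?mul1n // => z; rewrite in_lvl /=.
  apply/and3P/eqP => [[xz _ /eqP/(itv_length_eq0 xz)]//|->].
  by rewrite itv_length_refl lexx.
have {}xy : (x < y)%O.
  rewrite lt_neqAle xy andbT; apply/eqP => xy'.
  by rewrite xy' itv_length_refl in kl.
rewrite nmaxchains_rec //.
have lvlS a z : a \in lvl x y 1 -> (z \in lvl a y k) = (a <= z)%O && (z \in lvl x y k.+1).
  rewrite in_lvl1 => /andP[cov ay]; rewrite !in_lvl; have [xa _] := coversP _ _ cov.
  case: (boolP (a <= z)%O) => //= az.
  by rewrite (le_trans (ltW xa)) // (itv_length_covers cov az) eqSS.
under eq_bigr => a al.
  have := al; rewrite in_lvl1 => /andP[cov ay].
  rewrite (IH a) //; last by rewrite -ltnS -(itv_length_covers cov ay).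
  under eq_bigl => z do rewrite lvlS // andbC.
  over.
rewrite (exchange_big_dep (mem (lvl x y k.+1))) /=; last by move=> a z _ /andP[].
apply: eq_bigr => z; rewrite in_lvl => /and3P[xz zy /eqP lz].
rewrite -big_distrl /= (@nmaxchains_rec x z); last first.
  rewrite lt_neqAle xz andbT; apply/eqP => xz'.
  by rewrite xz' itv_length_refl in lz.
congr (_ * _); apply: eq_bigl => a; rewrite !in_lvl xz zy lz eqxx /=.
case: (boolP (a <= z)%O) => az; rewrite ?andbF // !andbT.
by rewrite (le_trans az zy).
Qed.

Lemma lvl_ex x y k : (x <= y)%O -> k <= itv_length x y -> exists z, z \in lvl x y k.
Proof.
move=> xy kl; apply/set0Pn/negP => /eqP l0.
by have := nmaxchains_gt0 xy; rewrite (nmaxchains_lvl xy kl) l0 big_set0.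
Qed.

End GradedIntervals.

(** * Factorial functions and Euler relations *)

Section AlternatingSums.
Import GRing.Theory Num.Theory.
Local Open Scope ring_scope.

(** Meant for [F] the difference between the level sizes and a multiple of binomial coefficients: it
    vanishes in the middle ranks, so an Euler relation reduces to its four extreme terms. *)
Lemma alternating_tail (n : nat) (F : nat -> rat) : (4 <= n)%N -> ~~ odd n ->
  \sum_(k < n.+1) (-1) ^+ k * F k = 0 ->
  (forall k, (2 <= k <= n - 2)%N -> F k = 0) ->
  F 0%N - F 1%N - F n.-1 + F n = 0.
Proof.
case: n => [|[|[|[|n]]]] // _ en; rewrite 2!big_ord_recr /= 2!big_ord_recl /= => sumF F0.
move: sumF; rewrite big1 => [|k _]; last first.
  by rewrite F0 ?mulr0 //= /bump /=; have := ltn_ord k; lia.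
rewrite /bump /= => sumF.
have e1 : (-1) ^+ n.+4 = 1 :> rat by rewrite -signr_odd (negPf en).
have e2 : (-1) ^+ n.+3 = -1 :> rat.
  by apply: (mulrI (unitrN1 _)); rewrite -exprS e1 mulrNN mulr1.
by move: sumF; rewrite e1 e2; lra.
Qed.

Lemma alternating_binomial (n : nat) : (0 < n)%N ->
  \sum_(k < n.+1) (-1) ^+ k * 'C(n, k)%:R = 0 :> rat.
Proof.
move=> n0; have := exprDn 1 (-1) n : (1 - 1) ^+ n = _ :> rat.
rewrite subrr expr0n eqn0Ngt n0 /= => e; apply: etrans (esym e); apply: eq_bigr => k _.
by rewrite expr1n mul1r mulr_natr.
Qed.

End AlternatingSums.

(** * Level sizes and Euler relations in terms of the factorial functions *)

Section Sheffer.
Context {d : Order.disp_t} {P : finTBPOrderType d}.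
Hypothesis euP : eulerian P.
Hypothesis shP : sheffer P.
Implicit Types x y z : P.

Local Notation B := (binomial_fact P).
Local Notation D := (sheffer_fact P).
Local Notation len := itv_length.
Local Notation rk := (@itv_length d P \bot%O).
Local Notation blvl := (@lvl d P \bot%O).

Lemma sheffer_graded x y : (x <= y)%O -> graded_itv x y.
Proof. by case: shP => gr _ _; apply: gr. Qed.
Local Notation gr := sheffer_graded.

Lemma len_add x z y : (x <= z)%O -> (z <= y)%O -> len x y = len x z + len z y.
Proof. exact: itv_length_add gr _ _ _. Qed.

(** The junk value is avoided because [(x, y)] is itself a candidate for [pick], and the Sheffer
    condition makes the choice of interval immaterial. *)
Lemma nmaxchains_binomial x y : (x <= y)%O -> x != \bot%O -> nmaxchains x y = B (len x y).
Proof.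
move=> xy x0; rewrite /binomial_fact; case: pickP => [[a b] /= /and3P[a0 ab /eqP l]|].
  by case: shP => _ _; apply.
by move=> /(_ (x, y)); rewrite /= x0 xy eqxx.
Qed.

Lemma nmaxchains_sheffer y : @nmaxchains d P \bot%O y = D (rk y).
Proof.
rewrite /sheffer_fact; case: pickP => [b /eqP l|].
  by case: shP => _ + _; apply.
by move=> /(_ y); rewrite eqxx.
Qed.

Lemma lvl_binomial x y k : (x <= y)%O -> x != \bot%O -> k <= len x y ->
  #|lvl x y k| * (B k * B (len x y - k)) = B (len x y).
Proof.
move=> xy x0 kl; rewrite -nmaxchains_binomial // (nmaxchains_lvl gr xy kl).
rewrite -sum_nat_const; apply: eq_bigr => z; rewrite in_lvl => /and3P[xz zy /eqP lz].
rewrite (len_add xz zy) lz addKn nmaxchains_binomial // lz nmaxchains_binomial //.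
by apply: contraNneq x0 => z0; move: xz; rewrite z0 lex0.
Qed.

(** Splitting chains at level [k]. Since [k] is positive, the upper half starts above the bottom and
    is counted by [B], while the lower half is counted by [D]. *)
Lemma lvl_sheffer y k : 0 < k <= rk y ->
  #|blvl y k| * (D k * B (rk y - k)) = D (rk y).
Proof.
move=> /andP[k0 kl]; rewrite -nmaxchains_sheffer // (nmaxchains_lvl gr (le0x _) kl).
rewrite -sum_nat_const; apply: eq_bigr => z; rewrite in_lvl => /and3P[xz zy /eqP lz].
rewrite (len_add xz zy) lz addKn nmaxchains_sheffer // lz nmaxchains_binomial //.
by apply: contraTneq k0 => z0; move: lz; rewrite z0 itv_length_refl => <-.
Qed.

Lemma lvl0 x y : (x <= y)%O -> lvl x y 0 = [set x].
Proof.
move=> xy; apply/setP => z; rewrite in_lvl inE.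
apply/and3P/eqP => [[xz _ /eqP /(itv_length_eq0 gr xz)]//|->].
by rewrite itv_length_refl lexx.
Qed.

Lemma lvl_top x y : (x <= y)%O -> lvl x y (len x y) = [set y].
Proof.
move=> xy; apply/setP => z; rewrite in_lvl inE; apply/and3P/eqP => [[xz zy]|->//].
move=> /eqP lz; apply: (itv_length_eq0 gr zy).
by have := len_add xz zy; lia.
Qed.

Section EulerRelation.
Import GRing.Theory Num.Theory.

Lemma euler_relation x y : (x < y)%O ->
  (\sum_(k < (len x y).+1) (-1) ^+ k * #|lvl x y k|%:R = 0 :> rat)%R.
Proof.
move=> xy; have [_ /(_ _ _ xy) eu] := euP.
suff H : (\sum_(z in itvset x y) (-1) ^+ (len x z) = 0 :> rat)%R.
  rewrite -[RHS]H (partition_big (fun z => inord (len x z) : 'I_(len x y).+1) xpredT) //=.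
  apply: eq_bigr => k _; rewrite mulr_natr -sumr_const.
  apply: congr_big => // z.
    rewrite in_lvl inE -andbA; case: (boolP (x <= z)%O) => //= xz.
    case: (boolP (z <= y)%O) => //= zy.
    by rewrite -val_eqE /= inordK // (len_add xz zy) ltnS leq_addr.
  by rewrite in_lvl => /and3P[_ _ /eqP ->].
(* The Eulerian condition speaks of ranks in [P], the goal of ranks in [[x, y]]; they differ by the
   constant [rank x], hence by a global sign. *)
have -> : (\sum_(z in itvset x y) (-1) ^+ (len x z) =
          (-1) ^+ (rank x) * \sum_(z in itvset x y) (-1) ^+ (rank z) :> rat)%R.
  rewrite big_distrr /=; apply: eq_bigr => z; rewrite inE => /andP[xz zy].
  rewrite /rank (len_add (le0x x) xz) exprD mulrA -exprD addnn.
  by rewrite -[((_).*2)]muln2 mulnC exprM sqrrN !expr1n mul1r.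
rewrite (bigID (fun z => odd (rank z))) /=.
rewrite (eq_bigr (fun=> (-1)%R)) => [|z /andP[_ oz]]; last by rewrite -signr_odd oz.
rewrite [X in (_ + X)%R](eq_bigr (fun=> 1%R)) => [|z /andP[_ oz]]; last first.
  by rewrite -signr_odd (negPf oz).
rewrite !big_const !iter_addr !addr0.
have cE (p : pred P) : #|[pred i | i \in itvset x y & p i]| = #|[set z in itvset x y | p z]|.
  by apply: eq_card => z; rewrite !inE.
by rewrite (cE (fun z => odd (rank z))) (cE (fun z => ~~ odd (rank z))) eu mulNrn addNr mulr0.
Qed.

End EulerRelation.

Lemma binomial_gt0 x y : (x <= y)%O -> x != \bot%O -> 0 < B (len x y).
Proof. by move=> xy x0; rewrite -nmaxchains_binomial // nmaxchains_gt0. Qed.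

End Sheffer.

(** * Atom counts of intervals not starting at the bottom *)

Section BinomialFactorials.
Context {d : Order.disp_t} {P : finTBPOrderType d}.
Hypothesis euP : eulerian P.
Hypothesis shP : sheffer P.
Implicit Types x y z : P.

Local Notation B := (binomial_fact P).
Local Notation len := itv_length.
Local Notation gr := (sheffer_graded shP).

Lemma neq_bot_le x z : x != \bot%O -> (x <= z)%O -> z != \bot%O.
Proof. by move=> x0 xz; apply: contraNneq x0 => z0; move: xz; rewrite z0 lex0. Qed.

Lemma binomial_len0 x : x != \bot%O -> B 0 = 1.
Proof.
by move=> x0; rewrite -{1}(itv_length_refl x) -nmaxchains_binomial ?lexx ?nmaxchains_refl.
Qed.

Lemma nmaxchains_len1 x y : (x <= y)%O -> len x y = 1 -> nmaxchains x y = 1.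
Proof.
move=> xy l1; rewrite (nmaxchains_rec gr); last first.
  by rewrite lt_neqAle xy andbT; apply/eqP => e; move: l1; rewrite e itv_length_refl.
by rewrite -{1}l1 lvl_top // big_set1 nmaxchains_refl.
Qed.

Lemma binomial_len1 x y : x != \bot%O -> (x < y)%O -> B 1 = 1.
Proof.
move=> x0 xy; have [z] := lvl_ex gr (ltW xy) (itv_length_gt0 gr xy).
rewrite in_lvl => /and3P[xz _ /eqP l1].
by rewrite -l1 -nmaxchains_binomial // nmaxchains_len1.
Qed.

Lemma binomial_lvl1 x y : x != \bot%O -> (x < y)%O ->
  #|lvl x y 1| * B (len x y).-1 = B (len x y).
Proof.
move=> x0 xy; rewrite -(lvl_binomial shP (ltW xy) x0 (itv_length_gt0 gr xy)).
by rewrite (binomial_len1 x0 xy) mul1n subn1.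
Qed.

Lemma binomial_lvl_pred x y : x != \bot%O -> (x < y)%O ->
  #|lvl x y (len x y).-1| * B (len x y).-1 = B (len x y).
Proof.
move=> x0 xy; rewrite -(lvl_binomial shP (ltW xy) x0 (leq_pred _)).
have l0 := itv_length_gt0 gr xy.
have -> : len x y - (len x y).-1 = 1 by lia.
by rewrite (binomial_len1 x0 xy) muln1.
Qed.

Lemma sub_lvl x y y' k : (y <= y')%O -> lvl x y k \subset lvl x y' k.
Proof.
move=> yy'; apply/subsetP => z; rewrite !in_lvl => /and3P[-> zy ->].
by rewrite (le_trans zy).
Qed.

Lemma euler_len2 x y : (x <= y)%O -> len x y = 2 -> #|lvl x y 1| = 2.
Proof.
move=> xy l2; have xy' : (x < y)%O.
  by rewrite lt_neqAle xy andbT; apply/eqP => e; move: l2; rewrite e itv_length_refl.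
have := euler_relation euP shP xy'.
have t2 : lvl x y 2 = [set y] by rewrite -l2 lvl_top.
rewrite l2 !big_ord_recr big_ord0 /= t2 (lvl0 shP xy) !cards1 => e.
have : (#|lvl x y 1|%:R = 2%:R :> rat)%R by lra.
by move=> /eqP; rewrite Num.Theory.eqr_nat => /eqP.
Qed.

Section EvenStep.
Import GRing.Theory Num.Theory.

(** With [q = B(n) / n!], level [k] has [q * 'C(n, k)] elements for [2 <= k <= n - 2]. Subtracting
    [q] times the alternating binomial sum from the Euler relation leaves [q (n - 1) = w - 1], where
    [w] is the number of atoms; and [q n (n - 1) = w b]. *)
Lemma binomial_even_relation x y b : x != \bot%O -> (x <= y)%O ->
  4 <= len x y -> ~~ odd (len x y) ->
  (forall k, k <= (len x y).-2 -> B k = k`!) ->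
  B (len x y).-1 = b * ((len x y).-2)`! ->
  #|lvl x y 1| * b + len x y = len x y * #|lvl x y 1|.
Proof.
move=> x0 xy n4 en Bf Bb.
have xy' : (x < y)%O.
  by rewrite lt_neqAle xy andbT; apply/eqP => e; move: n4; rewrite e itv_length_refl.
set n := len x y in n4 en Bf Bb *.
pose w := #|lvl x y 1|; rewrite -/w.
have Bn : B n = w * B n.-1 by rewrite -(binomial_lvl1 x0 xy').
(* Atoms and coatoms are equinumerous: either number times [B n.-1] is [B n], and [B n.-1] is
   positive because it counts chains of an actual interval. *)
have wn : #|lvl x y n.-1| = w.
  have := binomial_lvl_pred x0 xy'; rewrite -/n Bn => /eqP.
  have [z zl] := lvl_ex gr xy (leq_pred n).
  move: zl; rewrite in_lvl => /and3P[xz _ /eqP lz].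
  by rewrite eqn_pmul2r => [/eqP//|]; rewrite -lz binomial_gt0.
pose q : rat := ((B n)%:R / (n`!)%:R)%R.
have fn0 k : ((k`!)%:R != 0 :> rat)%R by rewrite pnatr_eq0 -lt0n fact_gt0.
have nfac : n`! = n * (n.-1 * n.-2`!).
  by case: n n4 {en Bf Bb Bn wn q} => [|[|n]] // _; rewrite !factS.
have qE : (q * (n%:R * (n.-1)%:R) = (w * b)%:R :> rat)%R.
  apply: (mulIf (fn0 n.-2)); rewrite -mulrA /q -[((n%:R * _ * _))%R]mulrA -!natrM -nfac.
  by rewrite mulfVK ?fn0 // Bn Bb mulnA.
have e1 : (\sum_(k < n.+1) (-1) ^+ k * (#|lvl x y k|%:R - q * 'C(n, k)%:R) = 0 :> rat)%R.
  under eq_bigr => k _ do rewrite mulrBr mulrCA.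
  rewrite sumrB -mulr_sumr (euler_relation euP shP xy') alternating_binomial ?mulr0 ?subr0 //.
  by lia.
have e2 k : 2 <= k <= n - 2 -> (#|lvl x y k|%:R - q * 'C(n, k)%:R = 0 :> rat)%R.
  move=> k2; have kn : k <= n by lia.
  apply/eqP; rewrite subr_eq0; apply/eqP; apply: (mulIf (fn0 n)).
  rewrite /q mulrAC mulfVK ?fn0 // -!natrM; congr (_%:R)%R.
  by rewrite -(lvl_binomial shP xy x0 kn) -/n -(bin_fact kn) !Bf; [ring|lia..].
have Cn1 : 'C(n, n.-1) = n by rewrite -subn1 bin_sub ?bin1; lia.
have := @alternating_tail n (fun k => #|lvl x y k|%:R - q * 'C(n, k)%:R)%R n4 en e1 e2.
rewrite (lvl0 shP xy) {4}/n (lvl_top shP xy) wn -/w !cards1 bin0 binn bin1 Cn1.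
have n0 : (n%:R != 0 :> rat)%R by rewrite pnatr_eq0; lia.
have n1E : ((n.-1)%:R = n%:R - 1 :> rat)%R.
  by rewrite -[in RHS](@prednK n) ?mulrS; [ring|lia].
move=> e; rewrite n1E in qE.
apply/eqP; rewrite -(eqr_nat rat) natrD -qE natrM; apply/eqP.
have h : (q * (n%:R - 1) = w%:R - 1 :> rat)%R by lra.
by rewrite mulrCA h; ring.
Qed.

End EvenStep.

End BinomialFactorials.

(** * Boolean intervals *)

Section BooleanIntervals.
Context {d : Order.disp_t} {P : finTBPOrderType d}.
Hypothesis euP : eulerian P.
Hypothesis shP : sheffer P.
Implicit Types x y z : P.

Local Notation B := (binomial_fact P).
Local Notation len := itv_length.
Local Notation gr := (sheffer_graded shP).

Lemma len_gt0_lt x y : (x <= y)%O -> 0 < len x y -> (x < y)%O.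
Proof.
move=> xy l0; rewrite lt_neqAle xy andbT; apply/eqP => e.
by move: l0; rewrite e itv_length_refl.
Qed.

Lemma binomial_len2 x y : x != \bot%O -> (x <= y)%O -> 2 <= len x y -> B 2 = 2.
Proof.
move=> x0 xy l2; have [z] := lvl_ex gr xy l2.
rewrite in_lvl => /and3P[xz zy /eqP lz].
have xz' : (x < z)%O by apply: len_gt0_lt; rewrite ?lz.
have := binomial_lvl1 shP x0 xz'; rewrite lz (euler_len2 euP shP) //=.
by rewrite (binomial_len1 shP x0 xz').
Qed.

(* The relation reads [n = w (n - b)]; as [w >= b >= n - 2], this forces
   [n - b = 1]. *)
Lemma even_relation_solve n b w : 4 <= n -> n.-2 <= b -> b <= w ->
  (n = 4 -> b = 3) -> w * b + n = n * w -> b = n.-1 /\ w = n.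
Proof.
move=> n4 nb bw b3 rel.
have t0 : w * (n - b) = n by rewrite mulnBr (mulnC w n) -rel addKn.
have [n5|n5] := leqP 5 n; last first.
  have nE : n = 4 by lia.
  by move: rel; rewrite (b3 nE) nE; lia.
have : n - b = 1; last by move=> e1; move: t0; rewrite e1; lia.
have : n - b <= 2 by lia.
by move: t0; case: (n - b) => [|[|[|?]]] //; lia.
Qed.

(** Induction by two ranks at a time: the Euler relation in even length [n] determines [B n.-1] and
    [B n] together from the smaller values. *)
Lemma binomial_factorial x y j : B 3 = 6 -> x != \bot%O -> (x <= y)%O ->
  (j.+1).*2 <= len x y -> forall k, k <= (j.+1).*2 -> B k = k`!.
Proof.
move=> B3 x0; elim: j y => [|j IH] y xy jl k kj.
  have xy' : (x < y)%O by apply: len_gt0_lt => //; lia.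
  case: k kj => [|[|[|k]]] kj; last by lia.
  - by rewrite (binomial_len0 shP x0).
  - by rewrite (binomial_len1 shP x0 xy').
  - by rewrite (binomial_len2 x0 xy).
have nj : (j.+2).*2 = (j.+1).*2.+2 by [].
have en : ~~ odd (j.+2).*2 by rewrite odd_double.
move: (j.+2).*2 => n in jl kj nj en *.
have n4 : 4 <= n by rewrite nj doubleS.
(* Nested intervals [[x, e]], [[x, c]], [[x, z]] of lengths [n - 2], [n - 1], [n] give atom counts
   [v <= b <= w], with [v = n - 2] known by induction. *)
have [z] := lvl_ex gr xy jl; rewrite in_lvl => /and3P[xz zy /eqP lz].
have Bf i : i <= n.-2 -> B i = i`! by move=> ?; apply: (IH y xy); lia.
have xz' : (x < z)%O by apply: len_gt0_lt => //; rewrite lz; clear -n4; lia.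
have [c] := @lvl_ex _ _ gr x z n.-1 xz ltac:(lia).
rewrite in_lvl => /and3P[xc cz /eqP lc].
have xc' : (x < c)%O by apply: len_gt0_lt => //; rewrite lc; clear -n4; lia.
have [e] := @lvl_ex _ _ gr x c n.-2 xc ltac:(lia).
rewrite in_lvl => /and3P[xe ec /eqP le].
have xe' : (x < e)%O by apply: len_gt0_lt => //; rewrite le; clear -n4; lia.
have := binomial_lvl1 shP x0 xz'; have := binomial_lvl1 shP x0 xc'.
have := binomial_lvl1 shP x0 xe'.
set w := #|lvl x z 1|; set b := #|lvl x c 1|; set v := #|lvl x e 1|.
rewrite lz lc le => Bv Bb Bw.
have bw : b <= w by apply/subset_leq_card/sub_lvl.
have vb : v <= b by apply/subset_leq_card/sub_lvl.
have factE k' : 0 < k' -> k'`! = k' * k'.-1`! by case: k' => // k' _; rewrite factS.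
have vE : v = n.-2.
  have := Bv; rewrite !Bf ?leq_pred // [RHS]factE; last by clear -n4; lia.
  by move=> /eqP; rewrite eqn_pmul2r ?fact_gt0 // => /eqP.
have rel : w * b + n = n * w.
  rewrite -lz; apply: (binomial_even_relation euP shP) => //; rewrite ?lz //.
  - by rewrite -Bb Bf.
have [bE wE] : b = n.-1 /\ w = n.
  (* In the base length 4, [b = 3] comes from [B 3 = 6] and [B 2 = 2]. *)
  apply: even_relation_solve rel => //; rewrite -?vE // => n4'.
  by have := Bb; rewrite n4' /= B3 (Bf 2) ?n4' // (_ : 2`! = 2) //; clear; lia.
have fE : n.-1`! = n.-1 * n.-2`! by rewrite factE //; clear -n4; lia.
have fE' : n`! = n * n.-1`! by rewrite factE //; clear -n4; lia.
move: kj; rewrite leq_eqVlt => /orP[/eqP->|].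
  by rewrite -Bw -Bb Bf // fE' fE wE bE.
rewrite leq_eqVlt => /orP[|kn]; last by apply: Bf; clear -kn; lia.
have -> : (k.+1 == n) = (k == n.-1) by clear -n4; lia.
by move=> /eqP ->; rewrite -Bb Bf // fE bE.
Qed.

Lemma card_lvl_factorial x y k : x != \bot%O -> (x <= y)%O ->
  (forall i, i <= len x y -> B i = i`!) -> k <= len x y ->
  #|lvl x y k| = 'C(len x y, k).
Proof.
move=> x0 xy Bf kl; have := lvl_binomial shP xy x0 kl.
rewrite !Bf ?leq_subr // -(bin_fact kl) => /eqP.
by rewrite eqn_pmul2r ?muln_gt0 ?fact_gt0 // => /eqP.
Qed.

Lemma in_lvl1_sub x y t : t \in lvl x y 1 -> [/\ (x <= t)%O, (t <= y)%O & len x t = 1].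
Proof. by rewrite in_lvl => /and3P[? ? /eqP]. Qed.

Lemma mem_lvl1 x y u t : t \in lvl x y 1 -> (t \in lvl x u 1) = (t <= u)%O.
Proof. by rewrite !in_lvl => /and3P[-> _ ->]; rewrite andbT. Qed.

(* In an interval counted by factorials, each atom is missed by exactly one
   coatom, by double counting. *)
Lemma factorial_coatom x y t : x != \bot%O -> (x <= y)%O ->
  (forall i, i <= len x y -> B i = i`!) -> t \in lvl x y 1 ->
  exists c, [/\ c \in lvl x y (len x y).-1, lvl x c 1 = lvl x y 1 :\ t &
    forall u, (x <= u <= y)%O -> ~~ (t <= u)%O -> (u <= c)%O].
Proof.
move=> x0 xy Bf tT; set k := len x y; set T := lvl x y 1; set M := lvl x y k.-1.
have k0 : 0 < k.
  by have [xt ty l] := in_lvl1_sub tT; rewrite /k (len_add shP xt ty) l.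
have cardT : #|T| = k by rewrite (card_lvl_factorial x0 xy Bf) ?bin1.
have cardM : #|M| = k.
  by rewrite (card_lvl_factorial x0 xy Bf) ?leq_pred // -subn1 bin_sub ?bin1.
have cardat u : (x <= u)%O -> (u <= y)%O -> #|lvl x u 1| = len x u.
  move=> xu uy; have lu := len_add shP xu uy.
  case: (posnP (len x u)) => [lu0|lu0].
    rewrite lu0 -(itv_length_eq0 gr xu lu0); apply: eq_card0 => z.
    rewrite in_lvl; apply/negP => /and3P[xz zx].
    by rewrite (@le_anti _ _ x z) ?xz // itv_length_refl.
  by rewrite (card_lvl_factorial x0 xu) ?bin1 // => i il; apply: Bf; lia.
have coat u : (x <= u)%O -> (u < y)%O -> #|lvl u y (len u y).-1| = len u y.
  move=> xu uy; have lu := len_add shP xu (ltW uy).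
  have lu0 := itv_length_gt0 gr uy.
  rewrite (card_lvl_factorial (neq_bot_le x0 xu) (ltW uy)) ?leq_pred //.
    by rewrite -subn1 bin_sub ?bin1.
  by move=> i il; apply: Bf; lia.
have inM u c : (x <= u)%O -> (u < y)%O -> (c \in lvl u y (len u y).-1) = (u <= c)%O && (c \in M).
  move=> xu uy; rewrite !in_lvl; case: (boolP (u <= c)%O) => //= uc.
  case: (boolP (c <= y)%O) => [cy|]; rewrite ?andbF //= (le_trans xu) //=.
  have := itv_length_gt0 gr uy.
  by rewrite (len_add shP xu uc) /k (len_add shP xu (ltW uy)); lia.
have lt_atom s : s \in T -> 1 < k -> (s < y)%O.
  move=> /in_lvl1_sub[xs sy l] k1; apply: len_gt0_lt => //.
  by move: k1; rewrite /k (len_add shP xs sy) l.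
(* The coatoms above [s] are those of [[s, y]], an interval of length [k - 1], so there are [k - 1]
   of them among [k]. For [k = 1] the only coatom is [x], and it is not above [s]. *)
have missed s : s \in T -> #|[set c in M | ~~ (s <= c)%O]| = 1.
  move=> sT; have [xs sy ls] := in_lvl1_sub sT.
  have ly := len_add shP xs sy.
  have := cardsID [set c | (s <= c)%O] M.
  have -> : M :\: [set c | (s <= c)%O] = [set c in M | ~~ (s <= c)%O].
    by apply/setP => c; rewrite !inE andbC.
  rewrite cardM; suff -> : #|M :&: [set c | (s <= c)%O]| = k.-1.
    by rewrite -{2}(prednK k0) -addn1 => /addnI.
  have [k1|k1] := leqP k 1.
    have -> : k.-1 = 0 by lia.
    apply: eq_card0 => c; apply/negP => /setIP[].
    rewrite in_lvl inE => /and3P[xc _ /eqP lc] sc.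
    by have := len_add shP xs sc; lia.
  rewrite (_ : k.-1 = len s y); last by rewrite /k ly ls.
  rewrite -(coat s xs (lt_atom s sT k1)); apply: eq_card => c.
  by rewrite (inM s c xs (lt_atom s sT k1)) in_setI inE [X in _ && X]inE andbC.
(* The coatom missing the atom [s]; the default [y] is never returned for an atom. *)
pose ct s := odflt y [pick c in M | ~~ (s <= c)%O].
have ctP s : s \in T -> ct s \in M /\ ~~ (s <= ct s)%O.
  move=> sT; rewrite /ct; case: pickP => [c /andP[]//|none].
  have /eqP := missed s sT; rewrite (_ : [set c in M | ~~ (s <= c)%O] = set0) ?cards0 //.
  by apply/setP => c; rewrite inE none inE.
have ct_uniq s c : s \in T -> c \in M -> ~~ (s <= c)%O -> c = ct s.
  move=> sT cM sc; have [ctM sct] := ctP s sT.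
  have /eqP/cards1P[e eE] := missed s sT.
  have : c \in [set e] by rewrite -eE inE cM.
  have : ct s \in [set e] by rewrite -eE inE ctM.
  by rewrite !inE => /eqP-> /eqP->.
have [ctM tct] := ctP t tT.
have := ctM; rewrite in_lvl => /and3P[xc cy /eqP lc].
exists (ct t); split=> //.
  apply/eqP; rewrite eqEcard; apply/andP; split.
    apply/subsetP => s sc; have := subsetP (sub_lvl x 1 cy) s sc => sT.
    rewrite in_setD1 sT andbT; apply: contraNneq tct => st; rewrite -{1}st.
    by rewrite -(mem_lvl1 _ sT).
  by rewrite cardat // lc; have := cardsD1 t T; rewrite tT cardT => ->.
move=> u /andP[xu uy] tu.
have uy' : (u < y)%O.
  rewrite lt_neqAle uy andbT; apply: contraNneq tu => ->.
  by have [] := in_lvl1_sub tT.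
(* Each coatom above [u] misses some atom, necessarily one not below [u]. There are [len u y] such
   coatoms and as many such atoms, so the inclusion is an equality, and [ct t] lies above [u]. *)
have sUV : lvl u y (len u y).-1 \subset ct @: (T :\: lvl x u 1).
  apply/subsetP => c; rewrite (inM u c xu uy') => /andP[uc cM].
  have := cM; rewrite in_lvl => /and3P[xc' cy' /eqP lc'].
  have /subsetPn[s sT sc] : ~~ (T \subset lvl x c 1).
    by apply/negP => /subset_leq_card; rewrite cardT cardat // lc' -ltnS prednK // ltnn.
  rewrite (mem_lvl1 _ sT) in sc; apply/imsetP; exists s; last exact: ct_uniq.
  rewrite inE sT andbT (mem_lvl1 _ sT); apply: contraNN sc => su.
  exact: le_trans su uc.
have : lvl u y (len u y).-1 == ct @: (T :\: lvl x u 1).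
  rewrite eqEcard sUV coat // (leq_trans (leq_imset_card _ _)) //.
  by rewrite cardsDS ?sub_lvl // cardT cardat // /k (len_add shP xu uy) addKn.
move=> /eqP E; have : ct t \in lvl u y (len u y).-1.
  by rewrite E imset_f // inE tT andbT (mem_lvl1 _ tT).
by rewrite (inM u _ xu uy') => /andP[].
Qed.

(** If [v] is not [y], it misses some atom [s], and so does [u]. Both are then below the coatom
    missing [s], and induction applies to the shorter interval under that coatom. *)
Lemma factorial_le x y u v : x != \bot%O -> (x <= y)%O ->
  (forall i, i <= len x y -> B i = i`!) ->
  (x <= u <= y)%O -> (x <= v <= y)%O ->
  lvl x u 1 \subset lvl x v 1 -> (u <= v)%O.
Proof.
move=> x0; have [n] := ubnP (len x y); elim: n y => // n IH y ln xy Bf xuy xvy suv.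
have /andP[xv vy] := xvy; have /andP[xu uy] := xuy.
have [->//|vy'] := eqVneq v y.
have [s sy sv] : exists2 s, s \in lvl x y 1 & s \notin lvl x v 1.
  apply/subsetPn; apply/negP => /subset_leq_card.
  have lv := len_add shP xv vy.
  have : (v < y)%O by rewrite lt_neqAle vy' vy.
  move=> /(itv_length_gt0 gr) lvy.
  rewrite (card_lvl_factorial x0 xy Bf) ?bin1; last by lia.
  case: (posnP (len x v)) => [lv0|lv0].
    rewrite -(itv_length_eq0 gr xv lv0) leqNgt => /negP; apply.
    rewrite [X in X < _]eq_card0; first by lia.
    move=> z; rewrite in_lvl; apply/negP => /and3P[xz zx].
    by rewrite (@le_anti _ _ x z) ?xz // itv_length_refl.
  rewrite (card_lvl_factorial x0 xv) ?bin1; [lia| |lia].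
  by move=> i il; apply: Bf; lia.
have [c [cM atc abv]] := factorial_coatom x0 xy Bf sy.
have su : s \notin lvl x u 1 by apply: contraNN sv; apply/subsetP.
rewrite (mem_lvl1 _ sy) in sv; rewrite (mem_lvl1 _ sy) in su.
have uc := abv u xuy su; have vc := abv v xvy sv.
move: cM; rewrite in_lvl => /and3P[xc cy /eqP lc].
have y0 : 0 < len x y.
  by have [xs sy' ls] := in_lvl1_sub sy; rewrite (len_add shP xs sy') ls.
have Bfc i : i <= len x c -> B i = i`!.
  by rewrite lc => il; apply: Bf; rewrite (leq_trans il) ?leq_pred.
have lcn : len x c < n by rewrite lc prednK.
by apply: (IH c lcn xc Bfc) suv; rewrite ?xu ?xv.
Qed.

(** As long as some atom is outside [S], the top [y] is replaced by the coatom missing exactly that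
    atom. *)
Lemma factorial_ex x y (S : {set P}) : x != \bot%O -> (x <= y)%O ->
  (forall i, i <= len x y -> B i = i`!) -> S \subset lvl x y 1 ->
  exists2 u, (x <= u <= y)%O & lvl x u 1 = S.
Proof.
move=> x0; have [n] := ubnP (len x y); elim: n y => // n IH y ln xy Bf sS.
have [->|SE] := eqVneq S (lvl x y 1); first by exists y; rewrite ?xy ?lexx.
have [s sy sS'] : exists2 s, s \in lvl x y 1 & s \notin S.
  by apply/subsetPn; apply: contraNN SE; rewrite eqEsubset sS.
have [c [cM atc _]] := factorial_coatom x0 xy Bf sy.
move: cM; rewrite in_lvl => /and3P[xc cy /eqP lc].
have y0 : 0 < len x y.
  by have [xs sy' ls] := in_lvl1_sub sy; rewrite (len_add shP xs sy') ls.
have Bfc i : i <= len x c -> B i = i`!.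
  by rewrite lc => il; apply: Bf; rewrite (leq_trans il) ?leq_pred.
have lcn : len x c < n by rewrite lc prednK.
have [|u /andP[xu uc] uS] := IH c lcn xc Bfc; first by rewrite atc subsetD1 sS.
by exists u => //; rewrite xu (le_trans uc).
Qed.

End BooleanIntervals.

(** * Lower intervals *)

Section ShefferFactorials.
Context {d : Order.disp_t} {P : finTBPOrderType d}.
Hypothesis euP : eulerian P.
Hypothesis shP : sheffer P.
Implicit Types r x y z : P.

Local Notation B := (binomial_fact P).
Local Notation D := (sheffer_fact P).
Local Notation len := itv_length.
Local Notation rk := (@itv_length d P \bot%O).
Local Notation blvl := (@lvl d P \bot%O).
Local Notation gr := (sheffer_graded shP).
Local Notation atoms z := (@lvl d P \bot%O z 1).

Lemma rank_add x y : (x <= y)%O -> rk y = rk x + len x y.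
Proof. by move=> xy; rewrite (len_add shP (le0x x) xy). Qed.

Lemma sheffer_len1 y : 0 < rk y -> D 1 = 1.
Proof.
move=> l0; have [z] := lvl_ex gr (le0x y) l0.
rewrite in_lvl => /and3P[_ _ /eqP l1].
by rewrite -l1 -nmaxchains_sheffer // nmaxchains_len1 // le0x.
Qed.

Lemma sheffer_atoms y : 0 < rk y ->
  #|atoms y| * B (rk y).-1 = D (rk y).
Proof.
by move=> l0; rewrite -(@lvl_sheffer _ _ shP y 1) // (sheffer_len1 l0) mul1n subn1.
Qed.

Lemma atom_neq_bot y x : x \in atoms y -> x != \bot%O.
Proof.
by move=> /in_lvl1_sub[_ _ l]; apply: contra_eqN l => /eqP ->; rewrite itv_length_refl.
Qed.

Section EvenStep.
Import GRing.Theory Num.Theory.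

(** Analogue of [binomial_even_relation] with [q = D(n) / (2 (n - 1)!)]: the middle level [k] has
    [q * 'C(n - 1, k - 1)] elements. The extreme terms give [2 + q (n - 1) = a + v], with [a] atoms
    and [v] coatoms, and [2 q (n - 1) = a c]. *)
Lemma sheffer_even_relation y c :
  4 <= rk y -> ~~ odd (rk y) ->
  (forall k, k <= (rk y).-2 -> B k = k`!) ->
  (forall k, 2 <= k <= (rk y).-2 -> D k = 2 * k.-1`!) ->
  B (rk y).-1 = c * ((rk y).-2)`! ->
  4 + #|atoms y| * c = 2 * #|atoms y| + 2 * #|blvl y (rk y).-1|.
Proof.
move=> n4 en Bf Df Bc.
have y0 : (\bot < y)%O by apply: (len_gt0_lt (le0x y)); exact: leq_trans n4.
set n := rk y in n4 en Bf Df Bc *.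
pose a := #|atoms y|; rewrite -/a; set v := #|lvl _ _ n.-1|.
have Dn : D n = a * B n.-1 by rewrite -sheffer_atoms //; lia.
pose q : rat := ((D n)%:R / (2 * n.-1`!)%:R)%R.
have fn0 k : ((k`!)%:R != 0 :> rat)%R by rewrite pnatr_eq0 -lt0n fact_gt0.
have f2n0 : ((2 * n.-1`!)%:R != 0 :> rat)%R.
  by rewrite pnatr_eq0 -lt0n muln_gt0 fact_gt0.
have nfac : n.-1`! = n.-1 * n.-2`!.
  by case: n n4 {en Bf Df Bc Dn q f2n0 v} => [|[|n]] // _; rewrite factS.
have qE : (2 * q * (n.-1)%:R = (a * c)%:R :> rat)%R.
  apply: (mulIf (fn0 n.-2)); rewrite -natrM -mulnA -Bc -Dn.
  rewrite -[((D n)%:R)%R](mulfVK f2n0) -/q nfac !natrM; ring.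
(* The binomial coefficients are shifted by one rank, so nothing is subtracted at rank 0. *)
pose F k := (#|blvl y k|%:R - if k is j.+1 then q * 'C(n.-1, j)%:R else 0)%R.
have e1 : (\sum_(k < n.+1) (-1) ^+ k * F k = 0 :> rat)%R.
  rewrite /F; under eq_bigr => k _ do rewrite mulrBr.
  rewrite sumrB (euler_relation euP shP y0) sub0r big_ord_recl /= mulr0 add0r.
  have := @alternating_binomial n.-1 ltac:(clear -n4; lia); rewrite prednK; last by clear -n4; lia.
  move=> alt; under eq_bigr => k _ do
    rewrite /bump leq0n add1n add0n exprS mulN1r mulNr mulrCA -mulrN.
  by rewrite -mulr_sumr sumrN alt oppr0 mulr0 oppr0.
have e2 k : 2 <= k <= n - 2 -> F k = 0%R.
  move=> k2; rewrite /F; case: k k2 => [|k] // k2.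
  apply/eqP; rewrite subr_eq0; apply/eqP; apply: (mulIf f2n0).
  rewrite /q mulrAC mulfVK // -!natrM; congr (_%:R)%R.
  have kn : k <= n.-1 by lia.
  rewrite -(@lvl_sheffer _ _ shP y k.+1) -/n; last by lia.
  rewrite -(bin_fact kn) Bf ?Df /=; [|lia..].
  by rewrite (_ : n - k.+1 = n.-1 - k); [ring|lia].
have Cn1 : 'C(n.-1, n.-2) = n.-1.
  by rewrite (_ : n.-2 = n.-1 - 1) ?bin_sub ?bin1 //; clear -n4; lia.
have F0 : F 0 = 1%R by rewrite /F (lvl0 shP (le0x y)) cards1 subr0.
have F1 : F 1 = (a%:R - q)%R by rewrite /F bin0 mulr1.
have Fn1 : F n.-1 = (v%:R - q * (n.-1)%:R)%R.
  rewrite /F -/v; congr (_ - _)%R.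
  by case: (n.-1) Cn1 => [_|k /= ->]; rewrite ?mulr0.
have Fn : F n = (1 - q)%R.
  rewrite /F {1}/n (lvl_top shP (le0x y)) cards1; congr (_ - _)%R.
  by case: (n) (n4) => // k _; rewrite binn mulr1.
have := @alternating_tail n F n4 en e1 e2; rewrite F0 F1 Fn1 Fn => e.
have : (4 + (a * c)%:R = 2 * a%:R + 2 * v%:R :> rat)%R by rewrite -qE; lra.
by rewrite -!natrM -!natrD => /eqP; rewrite eqr_nat => /eqP.
Qed.
End EvenStep.

(* The pairs of atoms below the rank-2 elements partition the atoms below [z]:
   two rank-2 elements over a common atom lie below a rank-3 element, which has
   only two atoms below it. *)
Lemma atoms_even z : 3 <= rk z ->
  (forall k, k < rk z -> B k = k`!) ->
  (forall r, 2 <= rk r <= 3 -> #|atoms r| = 2) ->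
  ~~ odd #|atoms z|.
Proof.
move=> l3 Bf two.
pose Q := [set atoms r | r in blvl z 2].
have two2 r : r \in blvl z 2 -> #|atoms r| = 2.
  by rewrite in_lvl => /and3P[_ _ /eqP l]; apply: two; rewrite l.
suff partQ : partition Q (atoms z).
  rewrite (@card_uniform_partition _ 2 Q) ?muln2 ?odd_double //.
  by move=> A /imsetP[r rl ->]; apply: two2.
apply/and3P; split.
- rewrite eqEsubset; apply/andP; split.
    apply/bigcupsP => A /imsetP[r]; rewrite in_lvl => /and3P[_ rz _] ->.
    exact: sub_lvl.
  apply/subsetP => x xz; have [_ lexz lx] := in_lvl1_sub xz.
  have lz := rank_add lexz.
  have [r] := @lvl_ex _ _ gr x z 1 lexz ltac:(clear -l3 lz lx; lia).
  rewrite in_lvl => /and3P[xr rz /eqP lr].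
  apply/bigcupP; exists (atoms r); last by rewrite (mem_lvl1 _ xz).
  by apply: imset_f; rewrite in_lvl le0x rz (rank_add xr) lx lr.
- apply/trivIsetP => A A' /imsetP[r rl ->] /imsetP[r' rl' ->].
  apply: contraR => /pred0Pn[x /andP[/= xr xr']].
  have [_ lxr lx] := in_lvl1_sub xr; have [_ lxr' _] := in_lvl1_sub xr'.
  have := rl; rewrite in_lvl => /and3P[_ rz /eqP lr].
  have := rl'; rewrite in_lvl => /and3P[_ rz' /eqP lr'].
  have x0 := atom_neq_bot xr.
  have xz := le_trans lxr rz.
  have lz := rank_add xz.
  have [->//|rr'] := eqVneq r r'.
  have r1 : r \in lvl x z 1.
    by rewrite in_lvl lxr rz /=; have := rank_add lxr; rewrite lr lx add1n => -[<-].
  have r1' : r' \in lvl x z 1.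
    by rewrite in_lvl lxr' rz' /=; have := rank_add lxr'; rewrite lr' lx add1n => -[<-].
  have Bfx i : i <= len x z -> B i = i`!.
    by move=> il; apply: Bf; rewrite lz lx add1n ltnS.
  have [|s /andP[xs sz] sE] := @factorial_ex _ _ shP x z [set r; r'] x0 xz Bfx.
    by apply/subsetP => e /set2P[] ->.
  have ls : len x s = 2.
    have := cards2 r r'; rewrite -sE rr' (card_lvl_factorial shP x0 xs); first by rewrite bin1.
      by move=> i il; apply: Bfx; rewrite (len_add shP xs sz) (leq_trans il) ?leq_addr.
    rewrite lt0n; apply/eqP => l0; have := itv_length_eq0 gr xs l0 => e.
    have : r \in lvl x s 1 by rewrite sE set21.
    rewrite -e => /in_lvl1_sub[xr1 rx]; rewrite (@le_anti _ _ r x) ?itv_length_refl //.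
    by rewrite rx.
  have ls3 : #|atoms s| = 2 by apply: two; rewrite (rank_add xs) lx ls.
  have sub e : e \in [set r; r'] -> (e <= s)%O.
    by rewrite -sE => /in_lvl1_sub[].
  have eqs e : e \in [set r; r'] -> #|atoms e| = 2 -> atoms e = atoms s.
    by move=> er e2; apply/eqP; rewrite eqEcard sub_lvl ?sub // ls3 e2.
  by rewrite (eqs r) ?set21 ?two2 // (eqs r') ?set22 ?two2.
- by apply/imsetP => -[r rl e]; have := two2 r rl; rewrite -e cards0.
Qed.

(** If [a' >= 4], then both [4 v] and [4 a] are at most [a c], so [2 a + 2 v <= a c], contradicting
    the first equation. *)
Lemma sheffer_relation_solve a a' c v : 4 <= c -> 2 <= a' -> ~~ odd a' ->
  4 + a * c = 2 * a + 2 * v -> v * a' = a * c -> a' = 2.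
Proof.
move=> c4 a2 ea rel va; have [a4|] := leqP 4 a'; last first.
  by move: a2 ea; case: a' {va} => [|[|[|[|]]]].
have : v * 4 <= a * c by rewrite -va leq_mul2l a4 orbT.
have : a * 4 <= a * c by rewrite leq_mul2l c4 orbT.
lia.
Qed.

(** Induction on an even bound [n], settling ranks [n - 1] and [n] together through a pair [z <= y]
    of these ranks. *)
Lemma atoms2 m : poset_rank P = 2 * m + 2 -> 0 < m -> B 3 = 6 -> D 3 = 4 ->
  (forall k, k <= 2 * m -> B k = k`!) ->
  forall y, 2 <= rk y -> #|atoms y| = 2.
Proof.
move=> rkP m0 B3 D3 Bf.
have rk2 y : rk y <= 2 * m + 2.
  by rewrite -rkP /poset_rank /rank (rank_add (lex1 y)) leq_addr.
have two2 y : rk y = 2 -> #|atoms y| = 2.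
  by move=> l; apply: (euler_len2 euP shP) => //; apply: le0x.
have two3 y : rk y = 3 -> #|atoms y| = 2.
  move=> l; have := @sheffer_atoms y; rewrite l D3 (Bf 2); last by clear -m0; lia.
  by rewrite (_ : 2`! = 2) //; clear; lia.
have two23 y : 2 <= rk y <= 3 -> #|atoms y| = 2.
  case: (rk y =P 2) => [/two2//|n2] l; apply: two3; clear -n2 l; lia.
have main n : 2 <= n -> ~~ odd n -> n <= 2 * m + 2 ->
  (forall y, 2 <= rk y <= n -> #|atoms y| = 2).
  elim/ltn_ind: n => n IH n2 en nm.
  have [n3|n4] := leqP n 3.
    by move=> y yl; apply: two23; clear -n3 yl; lia.
  have IHn y : 2 <= rk y <= n.-2 -> #|atoms y| = 2.
    apply: (IH n.-2); try (clear -n4 nm; lia).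
    by move: en; case: n {IH n2 nm} n4 => [|[|n]] //= _; rewrite negbK.
  have Df k : 2 <= k <= n.-2 -> D k = 2 * k.-1`!.
    move=> k2; have [z] := @lvl_ex _ _ gr \bot%O \top%O k (le0x _) ltac:(
      move: rkP; rewrite /poset_rank /rank => ->; clear -k2 nm; lia).
    rewrite in_lvl => /and3P[_ _ /eqP lz].
    have := @sheffer_atoms z; rewrite lz IHn ?lz // => <-; last by clear -k2; lia.
    by rewrite Bf //; clear -k2 nm; lia.
  have pair z y : (z <= y)%O -> rk z = n.-1 -> rk y = n ->
    #|atoms z| = 2 /\ #|atoms y| = 2.
    move=> zy lz ly.
    have [x xz] := @lvl_ex _ _ gr \bot%O z 1 (le0x z) ltac:(rewrite lz; clear -n4; lia).
    have x0 := atom_neq_bot xz; have [_ lexz lx] := in_lvl1_sub xz.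
    have xy := le_trans lexz zy.
    have lxz := rank_add lexz; have lxy := rank_add xy.
    have lxz' : len x z = n.-2 by clear -lxz lz lx; lia.
    have lxy' : len x y = n.-1 by clear -lxy ly lx; lia.
    have ltxy : (x < y)%O by apply: len_gt0_lt => //; rewrite lxy'; clear -n4; lia.
    have Bc := binomial_lvl1 shP x0 ltxy; rewrite lxy' in Bc.
    pose c := #|lvl x y 1|; rewrite -/c in Bc.
    have cn : n.-2 <= c.
      apply: leq_trans (subset_leq_card (sub_lvl x 1 zy)).
      rewrite (card_lvl_factorial shP x0 lexz) ?bin1 ?lxz' //; last by clear -n4; lia.
      by move=> i il; apply: Bf; clear -il nm; lia.
    have Bf' k : k <= n.-2 -> B k = k`! by move=> kn; apply: Bf; clear -kn nm; lia.
    have := @sheffer_even_relation y c; rewrite ly => rel.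
    have {}rel := rel n4 en Bf' Df; rewrite -Bc Bf' // in rel; have {}rel := rel erefl.
    (* The maximal chains below [y] are counted once by their atom and once by their coatom; the
       common factor [B n.-2] cancels. *)
    have va : #|blvl y n.-1| * #|atoms z| = #|atoms y| * c.
      have Dz := @sheffer_atoms z ltac:(rewrite lz; clear -n4; lia); rewrite lz in Dz.
      have Dy := @sheffer_atoms y ltac:(rewrite ly; clear -n4; lia); rewrite ly in Dy.
      have := @lvl_sheffer _ _ shP y n.-1 ltac:(rewrite ly; clear -n4; lia).
      rewrite ly -Dy -Dz -Bc (_ : n - n.-1 = 1); last by clear -n4; lia.
      rewrite (binomial_len1 shP x0 ltxy) muln1 !mulnA => /eqP.
      by rewrite eqn_pmul2r ?Bf' ?fact_gt0 // => /eqP.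
    (* For [n = 4], [z] has rank 3 and [D 3 = 4] decides. From [n = 6] on, [c >= n - 2 >= 4], and
       the parity of the atom count leaves only 2. *)
    have az2 : #|atoms z| = 2.
      have [n5|n5] := leqP n 5.
        by apply: two23; rewrite lz; clear -n4 n5 en; move: en; lia.
      apply: sheffer_relation_solve rel va.
      - by apply: leq_trans cn; clear -n5; lia.
      - have [r] := @lvl_ex _ _ gr \bot%O z 2 (le0x z) ltac:(rewrite lz; clear -n5; lia).
        rewrite in_lvl => /and3P[_ rz /eqP lr].
        by rewrite -(two2 r lr) subset_leq_card // sub_lvl.
      - apply: atoms_even => //; rewrite ?lz; first by clear -n5; lia.
        by move=> k kn; apply: Bf'; clear -kn; lia.
    by split=> //; move: rel va; rewrite az2; clear; lia.
  move=> y /andP[y2 yn].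
  have [yn2|yn2] := leqP (rk y) n.-2; first by apply: IHn; rewrite y2.
  have [ly|ly] := eqVneq (rk y) n.
    have [z] := @lvl_ex _ _ gr \bot%O y n.-1 (le0x y) ltac:(rewrite ly; clear; lia).
    rewrite in_lvl => /and3P[_ zy /eqP lz].
    by have [] := pair z y zy lz ly.
  have lyn : rk y = n.-1 by clear -yn yn2 ly; lia.
  (* An element of rank [n - 1] is not the top, so it lies below an element of rank [n] and can be
     the lower member of a pair. *)
  have yt : (y < \top)%O.
    rewrite lt_neqAle lex1 andbT; apply/eqP => e; move: rkP.
    by rewrite /poset_rank /rank -e lyn; clear -n4 nm; lia.
  have [z] := lvl_ex gr (ltW yt) (itv_length_gt0 gr yt).
  rewrite in_lvl => /and3P[yz _ /eqP lz].
  have [] // := pair y z yz lyn; rewrite (rank_add yz) lyn lz.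
  by clear -n4; lia.
move=> y y2; apply: (main (2 * m + 2)); rewrite ?y2 ?rk2 //; first by clear; lia.
by rewrite oddD oddM.
Qed.

End ShefferFactorials.

(** * The interval above an atom *)

Section UpperInterval.
Context {d : Order.disp_t} {P : finTBPOrderType d}.
Hypothesis shP : sheffer P.
Implicit Types p q s t u v w x y z c : P.

Local Notation B := (binomial_fact P).
Local Notation len := (@itv_length d P).
Local Notation gr := (sheffer_graded shP).
Local Notation top := (\top%O : P).

Variables (a : P) (m : nat).
Hypothesis m0 : 0 < m.
Hypothesis B3 : B 3 = 6.
Hypothesis Bf : forall k, k <= 2 * m -> B k = k`!.
Hypothesis a0 : a != \bot%O.
Hypothesis la : len a top = 2 * m + 1.

Local Notation at_ u := (@lvl d P a u 1).
Local Notation A := (@lvl d P a \top%O 1).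

Lemma len_proper u : (a <= u)%O -> (u < \top)%O -> len a u <= 2 * m.
Proof.
move=> au ut; have := len_add shP au (ltW ut); have := itv_length_gt0 gr ut.
rewrite la; clear; lia.
Qed.

Lemma len_proper_lt u : (a <= u)%O -> len a u <= 2 * m -> (u < \top)%O.
Proof.
move=> au lu; rewrite lt_neqAle lex1 andbT; apply/eqP => e.
by move: lu; rewrite e la; clear; lia.
Qed.

Lemma factorial_below u : (a <= u)%O -> (u < \top)%O ->
  forall i, i <= len a u -> B i = i`!.
Proof.
by move=> au ut i il; apply: Bf; rewrite (leq_trans il) ?len_proper.
Qed.

Lemma atom_len t : t \in A -> [/\ (a <= t)%O, (a < t)%O, len a t = 1,
  t != \bot%O & len t top = 2 * m].
Proof.
move=> /in_lvl1_sub[at_t tt lt]; split=> //.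
- by apply: len_gt0_lt; rewrite ?lt.
- exact: neq_bot_le a0 at_t.
- have e : len a top = len a t + len t top := len_add shP at_t tt.
  by move: e; rewrite la lt; clear; lia.
Qed.

Lemma factorial_above t : t \in A -> forall i, i <= len t top -> B i = i`!.
Proof. by move=> /atom_len[_ _ _ _ ->]; apply: Bf. Qed.

Lemma card_atoms_below u : (a <= u)%O -> (u < \top)%O -> #|at_ u| = len a u.
Proof.
move=> au ut; have [lu|lu] := posnP (len a u).
  rewrite lu -(itv_length_eq0 gr au lu); apply: eq_card0 => z.
  rewrite in_lvl; apply/negP => /and3P[az za].
  by rewrite (@le_anti _ _ a z) ?az // itv_length_refl.
by rewrite (card_lvl_factorial shP a0 au (factorial_below au ut)) ?bin1.
Qed.

Lemma in_atoms_below u t : t \in A -> (t \in at_ u) = (t <= u)%O.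
Proof. exact: mem_lvl1. Qed.

Lemma atoms_below_sub u : at_ u \subset A.
Proof. exact/sub_lvl/lex1. Qed.

Lemma le_atoms_below u v : (u <= v)%O -> at_ u \subset at_ v.
Proof. exact: sub_lvl. Qed.

Lemma lvl1_above_atom t p : t \in A -> (t <= p)%O -> (p \in lvl t \top%O 1) = (len a p == 2).
Proof.
move=> tA tp; have [at_t _ lt _ _] := atom_len tA.
by rewrite in_lvl tp lex1 /= (len_add shP at_t tp) lt.
Qed.

Lemma pair_ex s t c : s \in A -> t \in A -> s != t -> (s <= c)%O -> (t <= c)%O ->
  (c < \top)%O -> exists p, [/\ (a <= p)%O, (p <= c)%O, at_ p = [set s; t] & len a p = 2].
Proof.
move=> sA tA st sc tc ct; have [as_ _ _ _ _] := atom_len sA.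
have ac := le_trans as_ sc.
have [|p /andP[ap pc] pE] := factorial_ex shP (S := [set s; t]) a0 ac (factorial_below ac ct).
  by apply/subsetP => e /set2P[] ->; rewrite in_atoms_below.
exists p; split=> //; rewrite -card_atoms_below ?(le_lt_trans pc) //.
by rewrite pE cards2 st.
Qed.

(** The interval from [s] to the top has length [2m], hence is boolean. The element spanned there by
    [p] and [p'] has at most two of the [2m > 2] atoms, so it is not the top. *)
Lemma pair_join s p p' : 1 < m -> s \in A ->
  p \in lvl s \top%O 1 -> p' \in lvl s \top%O 1 ->
  exists q, [/\ (a <= q)%O, (q < \top)%O, (p <= q)%O & (p' <= q)%O].
Proof.
move=> m1 sA ps ps'; have [as_ _ ls s0 lst] := atom_len sA.
have [q /andP[sq qt] qE] : exists2 q, (s <= q <= \top)%O & lvl s q 1 = [set p; p'].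
  apply: (factorial_ex shP (S := [set p; p']) s0 (lex1 s) (factorial_above sA)).
  by apply/subsetP => e /set2P[] ->.
have aq := le_trans as_ sq; exists q; split=> //.
- rewrite lt_neqAle qt andbT; apply/eqP => e.
  have := card_lvl_factorial shP s0 (lex1 s) (factorial_above sA).
  move=> /(_ 1); rewrite lst -e qE bin1 cards2; move: m1; clear; case: (p != p'); lia.
- by have := set21 p p'; rewrite -qE => /in_lvl1_sub[].
- by have := set22 p p'; rewrite -qE => /in_lvl1_sub[].
Qed.

(** Covers the case out of reach of [pair_join]: for [m = 1] the whole interval above [a] has length
    3 and is itself boolean, because [B 3 = 6]. *)
Lemma factorial_rank3 : m = 1 -> forall i, i <= len a top -> B i = i`!.
Proof.
move=> m1 i; rewrite la m1 leq_eqVlt => /orP[/eqP->|]; first exact: B3.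
by move=> il; apply: Bf; rewrite m1.
Qed.

(** Both elements cover [s], so for [m > 1] they lie below some [q] other than the top, and in the
    boolean interval [[a, q]] elements are determined by their atoms. *)
Lemma pair_uniq s t p p' : s \in A -> (a <= p)%O -> (a <= p')%O ->
  (p < \top)%O -> (p' < \top)%O -> s != t ->
  at_ p = [set s; t] -> at_ p' = [set s; t] -> p = p'.
Proof.
move=> sA ap ap' pt pt' st pE pE'.
have half x x' : (a <= x)%O -> (a <= x')%O -> (x < \top)%O -> (x' < \top)%O ->
  at_ x = [set s; t] -> at_ x' = [set s; t] -> (x <= x')%O; last first.
  by apply/le_anti; rewrite (half p p') // (half p' p).
move=> ax ax' xt xt' xE xE'.
have sub : at_ x \subset at_ x' by rewrite xE xE'.
have [m1|m1] := leqP m 1.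
  have mE : m = 1 by clear -m1 m0; lia.
  by apply: (factorial_le shP a0 (lex1 a) (factorial_rank3 mE)); rewrite ?ax ?ax' ?lex1.
have lx y : (a <= y)%O -> (y < \top)%O -> at_ y = [set s; t] -> y \in lvl s \top%O 1.
  move=> ay yt yE; have sy : (s <= y)%O by rewrite -in_atoms_below // yE set21.
  by rewrite lvl1_above_atom // -card_atoms_below // yE cards2 st.
have [q [aq qt xq xq']] := pair_join m1 sA (lx x ax xt xE) (lx x' ax' xt' xE').
by apply: (factorial_le shP a0 aq (factorial_below aq qt)); rewrite ?ax ?ax'.
Qed.

Definition adj s t := [exists c, [&& (c < \top)%O, (s <= c)%O & (t <= c)%O]].

Lemma adjP s t : reflect (exists c, [/\ (c < \top)%O, (s <= c)%O & (t <= c)%O]) (adj s t).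
Proof. by apply: (iffP existsP) => -[c /and3P]; exists c. Qed.

Lemma adj_sym s t : adj s t = adj t s.
Proof. by apply: eq_existsb => c; rewrite [X in _ && X]andbC. Qed.

Lemma adj_refl s : s \in A -> adj s s.
Proof.
move=> sA; have [as_ _ ls _ _] := atom_len sA.
by apply/adjP; exists s; split=> //; apply: len_proper_lt; rewrite ?ls //; clear -m0; lia.
Qed.

(** The pairs [{u, v}] and [{u, w}] span two elements covering [u]; a common upper bound of these
    from [pair_join] is above [v] and [w]. *)
Lemma adj_trans u v w : u \in A -> v \in A -> w \in A -> adj u v -> adj u w -> adj v w.
Proof.
move=> uA vA wA uv uw.
have [->|vw] := eqVneq v w; first exact: adj_refl.
have [m1|m1] := leqP m 1.
  have mE : m = 1 by clear -m1 m0; lia.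
  have [|p /andP[ap pt] pE] :=
    factorial_ex shP (S := [set v; w]) a0 (lex1 a) (factorial_rank3 mE).
    by apply/subsetP => e /set2P[] ->.
  have le_p e : e \in [set v; w] -> (e <= p)%O by rewrite -pE => /in_lvl1_sub[].
  apply/adjP; exists p; rewrite !le_p ?set21 ?set22 //; split=> //.
  rewrite lt_neqAle pt andbT; apply/eqP => e.
  have := card_lvl_factorial shP a0 (lex1 a) (factorial_rank3 mE).
  by move=> /(_ 1); rewrite -e pE cards2 vw bin1 e la mE => /(_ isT).
have [uv_|nuv] := eqVneq u v; first by rewrite -uv_.
have [uw_|nuw] := eqVneq u w; first by rewrite -uw_ adj_sym.
have /adjP[c [ct uc vc]] := uv; have /adjP[c' [ct' uc' wc']] := uw.
have [p [ap pc pE lp]] := pair_ex uA vA nuv uc vc ct.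
have [p' [ap' pc' pE' lp']] := pair_ex uA wA nuw uc' wc' ct'.
have mem_p e x y : e \in [set x; y] -> forall r : P, at_ r = [set x; y] -> (e <= r)%O.
  by move=> + r rE; rewrite -rE => /in_lvl1_sub[].
have pu : p \in lvl u \top%O 1.
  by rewrite lvl1_above_atom ?lp // (mem_p u u v) ?set21.
have pu' : p' \in lvl u \top%O 1.
  by rewrite lvl1_above_atom ?lp' // (mem_p u u w) ?set21.
have [q [aq qt pq pq']] := pair_join m1 uA pu pu'.
apply/adjP; exists q; split=> //.
  by apply: le_trans pq; apply: (mem_p v u v); rewrite ?set22.
by apply: le_trans pq'; apply: (mem_p w u w); rewrite ?set22.
Qed.

Definition adj_class u := [set v in A | adj u v].

(** Besides [u], the class is in bijection with the [2m] elements covering [u]: each has exactly one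
    further atom below it. *)
Lemma card_adj_class u : u \in A -> #|adj_class u| = 2 * m + 1.
Proof.
move=> uA; have [au _ lu u0 lut] := atom_len uA.
(* The second atom below [p]; the default [u] is not reached when [p] covers [u]. *)
pose f p := odflt u [pick v in at_ p :\ u].
have fP p : p \in lvl u \top%O 1 ->
  [/\ (a <= p)%O, (p < \top)%O, f p \in A, f p != u & at_ p = [set u; f p]].
  move=> pu; have [up _ _] := in_lvl1_sub pu.
  have ap := le_trans au up.
  have lp : len a p = 2 by apply/eqP; rewrite -(lvl1_above_atom uA up).
  have pt : (p < \top)%O by apply: len_proper_lt; rewrite ?lp //; clear -m0; lia.
  have c2 : #|at_ p| = 2 by rewrite card_atoms_below.
  have up' : u \in at_ p by rewrite in_atoms_below.
  have c1 : #|at_ p :\ u| = 1 by have := cardsD1 u (at_ p); rewrite c2 up' => -[].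
  have /cards1P[v vE] : #|at_ p :\ u| == 1 by rewrite c1.
  have fv : f p = v.
    rewrite /f vE; case: pickP => [w /set1P//|/(_ v)]; by rewrite set11.
  have /setD1P[vu vp] : v \in at_ p :\ u by rewrite vE set11.
  rewrite fv; split=> //; first exact: (subsetP (atoms_below_sub p)).
  by rewrite -vE setD1K.
have -> : adj_class u = u |: (f @: lvl u \top%O 1).
  apply/setP => v; rewrite in_setU1 inE; apply/andP/orP => [[vA uv]|[/eqP->|/imsetP[p pu ->]]].
  - case: (eqVneq v u) => [->|vu]; [by left|right].
    have /adjP[c [ct uc vc]] := uv.
    have uv' : u != v by rewrite eq_sym.
    have [p [ap pc pE lp]] := pair_ex uA vA uv' uc vc ct.
    have up : (u <= p)%O by rewrite -in_atoms_below // pE set21.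
    apply/imsetP; exists p; first by rewrite lvl1_above_atom ?lp.
    have [_ _ _ fu] := fP p ltac:(by rewrite lvl1_above_atom ?lp).
    rewrite pE => e; have : v \in [set u; f p] by rewrite -e set22.
    by rewrite !inE (negPf vu) => /eqP.
  - by split=> //; apply: adj_refl.
  - have [ap pt fA fu pE] := fP p pu; split=> //.
    apply/adjP; exists p; split=> //; rewrite -in_atoms_below // pE ?set21 ?set22 //.
rewrite cardsU1 card_in_imset => [|p p' pu pu' ff].
  rewrite (card_lvl_factorial shP u0 (lex1 u) (factorial_above uA)) ?bin1 lut; last first.
    by clear -m0; lia.
  suff -> : u \notin f @: lvl u \top%O 1 by rewrite addnC.
  by apply/imsetP => -[p /fP[_ _ _ /eqP fu _] /esym].
have [ap pt fA fu pE] := fP p pu; have [ap' pt' _ _ pE'] := fP p' pu'.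
apply: (pair_uniq uA ap ap' pt pt' _ pE); first by rewrite eq_sym.
by rewrite ff.
Qed.

(** The comparison is made in the boolean interval from an atom [t] of [u] to the top. An element
    covering [t] below [u] is spanned by a pair [{t, s}] of atoms below [v], and by [pair_uniq] it
    is the one spanned by that pair below [v]. *)
Lemma atoms_below_le u v : (a <= u)%O -> (u < \top)%O -> (a <= v)%O -> (v < \top)%O ->
  at_ u \subset at_ v -> (u <= v)%O.
Proof.
move=> au ut av vt uv; have [<-//|nau] := eqVneq a u.
have ltau : (a < u)%O by rewrite lt_neqAle nau.
have [t tu] := lvl_ex gr au (itv_length_gt0 gr ltau).
have tA := subsetP (atoms_below_sub u) t tu.
have le_tu : (t <= u)%O by rewrite -in_atoms_below.
have le_tv : (t <= v)%O by rewrite -in_atoms_below // (subsetP uv).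
have [at_t _ lt t0 ltt] := atom_len tA.
apply: (factorial_le shP t0 (lex1 t) (factorial_above tA)); rewrite ?le_tu ?le_tv ?lex1 //.
apply/subsetP => p pu; have [tp le_pu lp1] := in_lvl1_sub pu.
have ap := le_trans at_t tp; have pt := le_lt_trans le_pu ut.
have lp : len a p = 2 by rewrite (len_add shP at_t tp) lt lp1.
have /cards1P[s sE] : #|at_ p :\ t| == 1.
  have := cardsD1 t (at_ p); rewrite card_atoms_below // lp in_atoms_below // tp.
  by rewrite add1n => -[<-].
have /setD1P[st sp] : s \in at_ p :\ t by rewrite sE set11.
have sA := subsetP (atoms_below_sub p) s sp.
have pE : at_ p = [set t; s] by rewrite -sE setD1K // in_atoms_below.
have sv : (s <= v)%O.
  by rewrite -in_atoms_below // (subsetP uv) // (subsetP (le_atoms_below le_pu)).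
have ts : t != s by rewrite eq_sym.
have [p' [ap' pv' pE' _]] := pair_ex tA sA ts le_tv sv vt.
have -> : p = p' by apply: (pair_uniq tA ap ap' pt _ ts pE pE'); apply: le_lt_trans vt.
have tp' : (t <= p')%O by rewrite -in_atoms_below // pE' set21.
have := pu; rewrite !in_lvl => /and3P[_ _ _].
rewrite tp' pv' /=; apply/eqP.
have -> : p' = p by apply: (pair_uniq tA ap' ap _ pt ts pE' pE); apply: le_lt_trans vt.
exact: lp1.
Qed.

(** In the boolean interval above [t], [u] is spanned by the elements whose two atoms are [t] and a
    member of [S]. The class member [r] outside [S] yields an element covering [t] that is not below
    [u], so [u] is not the top. *)
Lemma atoms_below_ex t (S : {set P}) : t \in S -> t \in A -> S \proper adj_class t ->
  exists u, [/\ (a <= u)%O, (u < \top)%O & at_ u = S].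
Proof.
move=> tS tA /properP[St [r rt rS]]; have [at_t _ lt t0 ltt] := atom_len tA.
have pairP s : s \in adj_class t -> t != s -> exists p,
    [/\ (a <= p)%O, (t <= p)%O, (s <= p)%O, at_ p = [set t; s] & p \in lvl t \top%O 1].
  rewrite inE => /andP[sA /adjP[c [ct tc sc]]] ts.
  have [p [ap pc pE lp]] := pair_ex tA sA ts tc sc ct.
  have tp : (t <= p)%O by rewrite -in_atoms_below // pE set21.
  have sp : (s <= p)%O by rewrite -in_atoms_below // pE set22.
  by exists p; rewrite lvl1_above_atom // lp.
pose PS := [set p in lvl t \top%O 1 | at_ p \subset S].
have [|u /andP[tu ut] uE] := factorial_ex shP (S := PS) t0 (lex1 t) (factorial_above tA).
  by apply/subsetP => p; rewrite inE => /andP[].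
have au := le_trans at_t tu.
have {}ut : (u < \top)%O.
  rewrite lt_neqAle ut andbT; apply/eqP => e.
  have tr : t != r by apply: contraNneq rS => <-.
  have [p [_ _ _ pE pt]] := pairP r rt tr.
  have : p \in PS by rewrite -uE e.
  rewrite inE pE => /andP[_ /subsetP/(_ r)]; rewrite set22 => /(_ isT).
  by rewrite (negPf rS).
exists u; split=> //; apply/setP => s; apply/idP/idP => [su|sS].
  have [->//|st] := eqVneq s t.
  have sA := subsetP (atoms_below_sub u) s su.
  have le_su : (s <= u)%O by rewrite -in_atoms_below.
  have ts : t != s by rewrite eq_sym.
  have [p [ap pu pE lp]] := pair_ex tA sA ts tu le_su ut.
  have tp : (t <= p)%O by rewrite -in_atoms_below // pE set21.
  have : p \in PS.
    rewrite -uE in_lvl tp pu /=.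
    by have := lvl1_above_atom tA tp; rewrite lp in_lvl tp lex1 /= => ->.
  by rewrite inE pE => /andP[_ /subsetP/(_ s)]; rewrite set22; apply.
have st' := subsetP St s sS; have sA : s \in A by move: st'; rewrite inE => /andP[].
rewrite in_atoms_below //; have [<-//|ts] := eqVneq t s.
have [p [ap tp sp pE pt]] := pairP s st' ts.
apply: le_trans sp _; have : p \in PS.
  by rewrite inE pt pE; apply/subsetP => e /set2P[] ->.
by rewrite -uE => /in_lvl1_sub[].
Qed.

End UpperInterval.

(** * The isomorphism with the dual suspension, and the factorial values *)

Section Isomorphism.
Context {d : Order.disp_t} {P : finTBPOrderType d}.
Hypothesis shP : sheffer P.
Implicit Types s t u v x y z : P.

Local Notation B := (binomial_fact P).
Local Notation len := (@itv_length d P).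
Local Notation gr := (sheffer_graded shP).
Local Notation top := (\top%O : P).

Variables (a : P) (m : nat).
Hypothesis m0 : 0 < m.
Hypothesis B3 : B 3 = 6.
Hypothesis Bf : forall k, k <= 2 * m -> B k = k`!.
Hypothesis a0 : a != \bot%O.
Hypothesis la : len a top = 2 * m + 1.

Local Notation at_ u := (@lvl d P a u 1).
Local Notation A := (@lvl d P a \top%O 1).
Local Notation N := (2 * m + 1).

Lemma adj_equivalence : {in A & &, equivalence_rel adj}.
Proof.
move=> x y z xA yA zA; split; first exact: (adj_refl shP m0 a0 la zA).
have tr := adj_trans shP m0 B3 Bf a0 la.
move=> xy; apply/idP/idP => [xz|yz]; first exact: tr xA yA zA xy xz.
by apply: (tr y) => //; rewrite adj_sym.
Qed.

Lemma class_enum : exists (alpha : nat) (e : 'I_alpha -> 'I_N -> P),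
  [/\ #|A| = alpha * N, forall i, injective (e i), forall i j, e i j \in A,
      forall i j, adj_class a (e i j) = [set e i k | k in [set: 'I_N]] &
      (forall i i' j j', e i j = e i' j' -> i = i') /\
      (forall t, t \in A -> exists i, exists j, t = e i j)].
Proof.
pose Q := equivalence_partition adj A.
have partQ : partition Q A := equivalence_partitionP adj_equivalence.
have sizeQ K : K \in Q -> #|K| = N.
  by move=> /imsetP[x xA ->]; rewrite -(card_adj_class shP m0 B3 Bf a0 la xA).
have classQ K x : K \in Q -> x \in K -> adj_class a x = K.
  move=> /imsetP[y yA ->]; rewrite inE => /andP[xA yx].
  apply/setP => z; rewrite [LHS]in_set [RHS]in_set.
  case: (boolP (z \in A)) => //= zA.
  by have [_ /(_ yx) ->] := adj_equivalence yA xA zA.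
(* Member [j] of class [i]; the default [a] is never read, since every class has exactly [N]
   elements. *)
pose e (i : 'I_#|Q|) (j : 'I_N) := nth a (enum (enum_val i)) j.
have sz (i : 'I_#|Q|) : size (enum (enum_val i)) = N.
  by rewrite -cardE sizeQ // enum_valP.
have eK i j : e i j \in enum_val i by rewrite -mem_enum mem_nth // sz.
have KA (i : 'I_#|Q|) : {subset enum_val i <= A}.
  have /and3P[/eqP <- _ _] := partQ; move=> x xK.
  by apply/bigcupP; exists (enum_val i) => //; apply: enum_valP.
have e_inj i : injective (e i).
  move=> j j' /eqP; rewrite nth_uniq ?sz ?enum_uniq // => /eqP; exact: val_inj.
exists #|Q|, e; split=> //.
- exact: card_uniform_partition partQ.
- by move=> i j; apply: KA (eK i j).
- move=> i j; rewrite (classQ (enum_val i)) ?enum_valP //; apply/eqP.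
  rewrite eq_sym eqEcard card_imset // cardsT card_ord sizeQ ?enum_valP // leqnn andbT.
  by apply/subsetP => x /imsetP[k _ ->].
split=> [i i' j j' ee|t tA].
  apply: enum_val_inj; rewrite -(classQ (enum_val i) (e i j)) ?enum_valP //.
  by rewrite ee (classQ (enum_val i')) ?enum_valP.
have tQ : adj_class a t \in Q by apply: imset_f.
have tt : t \in adj_class a t by rewrite inE tA (adj_refl shP m0 a0 la tA).
have tE : t \in enum (enum_val (enum_rank_in tQ (adj_class a t))).
  by rewrite enum_rankK_in // mem_enum.
have lt : index t (enum (enum_val (enum_rank_in tQ (adj_class a t)))) < N.
  by rewrite -(sz (enum_rank_in tQ (adj_class a t))) index_mem.
by exists (enum_rank_in tQ (adj_class a t)), (Ordinal lt); rewrite /e /= nth_index.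
Qed.

Section Construction.
Variables (alpha : nat) (e : 'I_alpha -> 'I_N -> P) (a' : P).
Hypothesis e_inj : forall i, injective (e i).
Hypothesis eA : forall i j, e i j \in A.
Hypothesis eclass : forall i j, adj_class a (e i j) = [set e i k | k in [set: 'I_N]].
Hypothesis e_sep : forall i i' j j', e i j = e i' j' -> i = i'.
Hypothesis e_surj : forall t, t \in A -> exists i, exists j, t = e i j.
Hypothesis aa' : ~~ (a <= a')%O /\ ~~ (a' <= a)%O.
Hypothesis above : forall z, z != \bot%O -> z != a -> z != a' -> (a < z)%O /\ (a' < z)%O.

Local Notation Q := (dual_susp (boxplus alpha (boolean_lattice N))).
Import Order.DefaultSetSubsetOrder.

Definition middle (i : 'I_alpha) (S : {set 'I_N}) : P :=
  odflt top [pick u | [&& (a <= u)%O, (u < \top)%O & at_ u == e i @: S]].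

Lemma middleP i (S : {set 'I_N}) : S != set0 -> S != setT ->
  [/\ (a <= middle i S)%O, (middle i S < \top)%O, at_ (middle i S) = e i @: S &
      (a < middle i S)%O].
Proof.
move=> S0 S1; have [j jS] := set0Pn _ S0.
have prop : e i @: S \proper adj_class a (e i j).
  rewrite eclass properE imsetS ?subsetT //=; apply: contraNN S1.
  move=> /subsetP sub; rewrite -subTset; apply/subsetP => k _.
  have /imsetP[k' k'S /e_inj ->] : e i k \in e i @: S by apply/sub/imset_f.
  exact: k'S.
have [u [au ut uS]] := atoms_below_ex shP Bf a0 la (imset_f _ jS) (eA i j) prop.
rewrite /middle; case: pickP => [w /and3P[aw wt /eqP wS]|/(_ u)] /=; last first.
  by rewrite au ut uS eqxx.
split=> //; rewrite lt_neqAle aw andbT; apply: contraTneq (imset_f (e i) jS) => aw'.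
rewrite -wS -aw'; apply/negP => /in_lvl1_sub[_ ea].
have [_ lt _ _ _] := atom_len shP a0 la (eA i j).
by rewrite lt_geF in ea.
Qed.

Definition to_poset (q : Q) : P :=
  match q with
  | DsOld BpBot => \bot%O
  | DsOld BpTop => \top%O
  | DsOld (BpIn i T) => middle i (val T)
  | DsNew b => if b then a' else a
  end.

Local Notation inner := {x : boolean_lattice N | (x != \bot%O) && (x != \top%O)}.

Lemma inner_set (T : inner) :
  (val T : {set 'I_N}) != set0 /\ (val T : {set 'I_N}) != setT.
Proof. by have /andP[] := valP T. Qed.

Lemma middle_le i j (S T : {set 'I_N}) :
  S != set0 -> S != setT -> T != set0 -> T != setT ->
  (middle i S <= middle j T)%O = (i == j) && (S \subset T).
Proof.
move=> S0 S1 T0 T1; have [aS St SE _] := middleP i S0 S1.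
have [aT Tt TE _] := middleP j T0 T1.
apply/idP/andP => [ST|[/eqP ij ST]]; last first.
  apply: (atoms_below_le shP m0 B3 Bf a0 la aS St aT Tt).
  by rewrite SE TE ij imsetS.
have /subsetP sub : e i @: S \subset e j @: T by rewrite -SE -TE; apply: sub_lvl.
have ij : i = j.
  have [k kS] := set0Pn _ S0.
  by have /imsetP[k' _ /e_sep] := sub _ (imset_f (e i) kS).
split; first exact/eqP; apply/subsetP => k kS.
have /imsetP[k' k'T] := sub _ (imset_f (e i) kS).
by rewrite -ij => /e_inj ->.
Qed.

Lemma to_poset_mono : {mono to_poset : x y / (x <= y)%O}.
Proof.
have at_ : (a < \top)%O by apply: len_gt0_lt; rewrite ?lex1 // la addn1.
have [na na'] := aa'.
have a't : (a' < \top)%O.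
  by rewrite lt_neqAle lex1 andbT; apply: contraNneq na => ->; rewrite lex1.
have a'0 : a' != \bot%O by apply: contraNneq na' => ->; rewrite le0x.
have mid i (S : inner) :
  [/\ (a < middle i (val S))%O, (a' < middle i (val S))%O & (middle i (val S) < \top)%O].
  have [S0 S1] := inner_set S; have [_ St _ aS] := middleP i S0 S1.
  split=> //; have [] // := above (z := middle i (val S)).
  - by apply: contraTneq aS => ->; rewrite ltx0.
  - by rewrite gt_eqF.
  - by apply: contraNneq na => <-; apply: ltW.
have mid0 i (S : inner) : (middle i (val S) <= \bot)%O = false.
  have [aS _ _] := mid i S; apply/negP; rewrite lex0 => /eqP e0.
  by rewrite e0 ltx0 in aS.
suff mono (x y : Q) : (to_poset x <= to_poset y)%O = dual_susp_le x y by [].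
case: x => [[||i S]|b]; case: y => [[||j T]|c] /=; rewrite ?lexx ?lex1 ?le0x //.
- by rewrite lex0 gt_eqF // (le_lt_trans (le0x a)).
- by have [_ _ Tt] := mid j T; rewrite lt_geF.
- by case: c; rewrite lt_geF.
- by rewrite mid0.
- have [S0 S1] := inner_set S; have [T0 T1] := inner_set T.
  by rewrite middle_le.
- by have [aS aS' _] := mid i S; case: c; rewrite lt_geF.
- by case: b; rewrite lex0 ?(negPf a0) ?(negPf a'0) ltxx.
- by have [aT aT' _] := mid j T; case: b; rewrite ltW.
- by case: b; case: c; rewrite ?lexx ?(negPf na) ?(negPf na').
Qed.

Lemma to_poset_surj z : exists q, to_poset q = z.
Proof.
have [->|z0] := eqVneq z \bot%O; first by exists (DsOld (BpBot _ _)).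
have [->|z1] := eqVneq z \top%O; first by exists (DsOld (BpTop _ _)).
have [->|za] := eqVneq z a; first by exists (DsNew _ false).
have [->|za'] := eqVneq z a'; first by exists (DsNew _ true).
have [az _] := above z0 za za'.
have zt : (z < \top)%O by rewrite lt_neqAle z1 lex1.
have [t tz] := lvl_ex gr (ltW az) (itv_length_gt0 gr az).
have tA := subsetP (atoms_below_sub a z) t tz.
have [i [j tE]] := e_surj tA.
(* All atoms below [z] lie in the class of [t], with [z] itself as common upper bound, so [S]
   records every one of them. *)
pose S := e i @^-1: at_ z.
have SE : e i @: S = at_ z.
  apply/setP => x; apply/imsetP/idP => [[k kS ->]|xz]; first by rewrite inE in kS.
  have xA := subsetP (atoms_below_sub a z) x xz.
  have : x \in adj_class a (e i j).
    rewrite inE xA -tE; apply/adjP; exists z; split=> //.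
      by rewrite -(in_atoms_below z tA).
    by rewrite -(in_atoms_below z xA).
  by rewrite eclass => /imsetP[k _ xE]; exists k => //; rewrite inE -xE.
have S0 : S != set0 by apply/set0Pn; exists j; rewrite inE -tE.
have S1 : S != setT.
  (* A full [S] would give [2m + 1] atoms below [z], while an element other than the top has at most
     [2m]. *)
  apply/eqP => ST; have := card_imset S (@e_inj i).
  rewrite SE ST cardsT card_ord (card_atoms_below shP Bf a0 la (ltW az) zt).
  have := len_proper shP la (ltW az) zt; clear; lia.
have SP : (S != \bot%O :> boolean_lattice N) && (S != \top%O :> boolean_lattice N).
  by rewrite S0 S1.
exists (DsOld (BpIn i (exist _ (S : boolean_lattice N) SP))) => /=.
have [aS St SE' _] := middleP i S0 S1.
apply/le_anti; have le := atoms_below_le shP m0 B3 Bf a0 la.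
by rewrite (le _ _ aS St (ltW az) zt) ?(le _ _ (ltW az) zt aS St) // SE' SE.
Qed.

Lemma sheffer_iso : poset_iso P Q.
Proof.
have inj : injective to_poset.
  by move=> x y exy; apply/le_anti; rewrite -!to_poset_mono exy lexx.
have [f fK] : exists f, cancel f to_poset.
  have surj z : exists q, to_poset q == z.
    by have [q qz] := to_poset_surj z; exists q; apply/eqP.
  by exists (fun z => xchoose (surj z)) => z; apply/eqP/(xchooseP (surj z)).
have Kf : cancel to_poset f by move=> x; apply: inj; rewrite fK.
exists f; first by exists to_poset.
by move=> x y; rewrite -to_poset_mono !fK.
Qed.

End Construction.
End Isomorphism.

Theorem theorem4p13 (d : Order.disp_t) (P : finTBPOrderType d) (m : nat) :
  eulerian P -> sheffer P ->
  poset_rank P = 2 * m + 2 -> 4 <= 2 * m + 2 ->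
  binomial_fact P 3 = 6 -> sheffer_fact P 3 = 4 ->
  exists alpha : nat,
    [/\ 0 < alpha,
        ((binomial_fact P (2 * m + 1)%N)%:R / ((2 * m + 1)`!)%:R
           = alpha%:R :> rat)%R,
        poset_iso P (dual_susp (boxplus alpha (boolean_lattice (2 * m + 1)))) &
        [/\ forall k, 1 <= k <= 2 * m -> binomial_fact P k = k`!,
            binomial_fact P (2 * m + 1) = alpha * (2 * m + 1)`!,
            sheffer_fact P 1 = 1,
            forall k, 2 <= k <= 2 * m + 1 -> sheffer_fact P k = 2 * (k - 1)`! &
            sheffer_fact P (2 * m + 2) = 2 * alpha * (2 * m + 1)`!]].
Proof.
move=> euP shP rkP m4 B3 D3; have m0 : 0 < m by clear -m4; lia.
have gr := sheffer_graded shP.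
set rk := @itv_length d P \bot%O.
have rkt : rk \top%O = 2 * m + 2 by [].
have lvlP x y k z : z \in @lvl d P x y k -> [/\ (x <= z)%O, (z <= y)%O & itv_length x z = k].
  by rewrite in_lvl => /and3P[? ? /eqP].
have rk_ex k : k <= 2 * m + 2 -> exists z, rk z = k.
  rewrite -rkt => kl; have [z zl] := lvl_ex gr (le0x _) kl.
  by exists z; have [] := lvlP _ _ _ _ zl.
have [a la] : exists a, rk a = 1 by apply: rk_ex; clear; lia.
have rkD x y : (x <= y)%O -> rk y = rk x + itv_length x y by apply: rank_add.
have lat : @itv_length d P a \top%O = 2 * m + 1.
  by have := rkD a \top%O (lex1 a); rewrite rkt la; clear; lia.
have a0 : a != \bot%O.
  by apply/eqP => ae; move: la; rewrite ae /rk itv_length_refl.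
have Bf k : k <= 2 * m -> binomial_fact P k = k`!.
  have mE : (m.-1.+1).*2 = 2 * m by clear -m0; lia.
  move=> km; apply: (binomial_factorial euP shP (j := m.-1) B3 a0 (lex1 a)); rewrite mE //.
  by rewrite lat; clear; lia.
have two := atoms2 euP shP rkP m0 B3 D3 Bf.
have aT : a \in @lvl d P \bot%O \top%O 1 by rewrite in_lvl le0x lex1; apply/eqP.
have c2 : #|@lvl d P \bot%O \top%O 1| = 2.
  by apply: two; rewrite -/rk rkt; clear; lia.
have /cards1P[a' a'E] : #|@lvl d P \bot%O \top%O 1 :\ a| == 1.
  by have := cardsD1 a (@lvl d P \bot%O \top%O 1); rewrite c2 aT add1n => -[<-].
have /setD1P[aa' a'T] : a' \in @lvl d P \bot%O \top%O 1 :\ a by rewrite a'E set11.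
have TE : @lvl d P \bot%O \top%O 1 = [set a; a'] by rewrite -a'E setD1K.
have la' : rk a' = 1 by have [] := lvlP _ _ _ _ a'T.
have anti x y : rk x = 1 -> rk y = 1 -> (x <= y)%O -> x = y.
  move=> lx ly xy; apply: (itv_length_eq0 gr xy).
  by have := rkD x y xy; rewrite lx ly; clear; lia.
have naa' : ~~ (a <= a')%O /\ ~~ (a' <= a)%O.
  split; apply/negP => le; move: aa'; first by rewrite (anti _ _ la la' le) eqxx.
  by rewrite (anti _ _ la' la le) eqxx.
(* Such a [z] has rank at least 2, hence exactly two atoms below it, and [a], [a'] are the only
   atoms of [P]. *)
have above z : z != \bot%O -> z != a -> z != a' -> (a < z)%O /\ (a' < z)%O.
  move=> z0 za za'.
  have rz0 : 0 < rk z.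
    by rewrite lt0n; apply: contraNneq z0 => /(itv_length_eq0 gr (le0x z)) <-.
  have rz1 : rk z != 1.
    apply/eqP => rz; have : z \in [set a; a'] by rewrite -TE in_lvl le0x lex1; apply/eqP.
    by rewrite !inE (negPf za) (negPf za').
  have rz2 : 2 <= rk z by clear -rz0 rz1; lia.
  have zE : @lvl d P \bot%O z 1 = @lvl d P \bot%O \top%O 1.
    by apply/eqP; rewrite eqEcard sub_lvl ?lex1 // c2 two.
  have le x : x \in [set a; a'] -> (x <= z)%O.
    by rewrite -TE -zE => xz; have [] := lvlP _ _ _ _ xz.
  by rewrite !lt_neqAle !le ?set21 ?set22 // !andbT ![_ == z]eq_sym.
have [alpha [e [cA e_inj eA eclass [e_sep e_surj]]]] := class_enum shP m0 B3 Bf a0 lat.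
have iso := sheffer_iso shP m0 B3 Bf a0 lat e_inj eA eclass e_sep e_surj naa' above.
have at_ : (a < \top)%O by apply: len_gt0_lt; rewrite ?lex1 // lat addn1.
(* There are [alpha * (2m + 1)] atoms above [a], each starting [(2m)!] maximal chains. *)
have BN : binomial_fact P (2 * m + 1) = alpha * (2 * m + 1)`!.
  have := binomial_lvl1 shP a0 at_; rewrite lat cA addn1 /= => <-.
  by rewrite Bf // factS mulnA.
have alpha0 : 0 < alpha.
  have := binomial_gt0 shP (ltW at_) a0; rewrite lat BN muln_gt0.
  by case/andP.
have DE z : 2 <= rk z -> sheffer_fact P (rk z) = 2 * binomial_fact P (rk z).-1.
  by move=> rz; rewrite -(sheffer_atoms shP) ?two // -/rk (leq_trans _ rz).
exists alpha; split=> //.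
  rewrite BN GRing.natrM GRing.mulfK // Num.Theory.pnatr_eq0 -lt0n fact_gt0 //.
split=> //.
- by move=> k /andP[_ /Bf].
- by apply: (sheffer_len1 shP (y := a)); rewrite -/rk la.
- move=> k /andP[k2 km]; have [z zk] := rk_ex k ltac:(clear -km; lia).
  by have := DE z; rewrite zk subn1 => -> //; rewrite Bf //; clear -k2 km; lia.
- have := DE \top%O; rewrite rkt => ->; last by clear; lia.
  by rewrite (_ : (2 * m + 2).-1 = 2 * m + 1) ?BN ?mulnA //; clear; lia.
Qed.
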